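(* Let $\alpha>0$, $(a,b)\in\mathbb{R}^2$ with $a<b$, and $f\in S_b^\alpha(L^1)$. Then $$S_b^\alpha\left(\mathcal{D}_b^\alpha f\right)(x)=-f(x),\quad \text{for a.e. } x\in[a,b].$$
   Context: Let $E_1(x)=\int_x^\infty \frac{e^{-t}}{t}\,dt$ for $x>0$ and $\mathcal{S}(t)=e^{-t}\int_0^\infty \frac{t^{s-1}}{\Gamma(s)}\,ds$ for $t>0$, where $\Gamma$ is the Gamma function. For $\alpha>0$ and $f\in L^1([a,b];\mathbb{R})$, define for a.e. $x\in[a,b]$ $$(J_b^\alpha f)(x)=\frac{1}{\alpha}\int_x^b E_1\left(\frac{t-x}{\alpha}\right)f(t)\,dt,\qquad (S_b^\alpha f)(x)=\int_x^b \mathcal{S}\left(\frac{t-x}{\alpha}\right)f(t)\,dt.$$ A function in $L^1([a,b];\mathbb{R})$ has an absolutely continuous representative if it coincides a.e. on $[a,b]$ with an absolutely continuous function on $[a,b]$; it is then identified with that function. If $J_b^\alpha f$ has an absolutely continuous representative, the right-sided fractional derivative of order $\alpha$ of $f$ is $(\mathcal{D}_b^\alpha f)(x)=\frac{d}{dx}(J_b^\alpha f)(x)$ for a.e. $x\in[a,b]$. The space $S_b^\alpha(L^1)$ is $\{S_b^\alpha\varphi:\ \varphi\in L^1([a,b];\mathbb{R})\}$. *)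

(* Defs.v *)
From mathcomp Require Import all_boot all_order all_algebra.
From mathcomp Require Import all_classical all_reals all_analysis.

Set Implicit Arguments.
Unset Strict Implicit.
Unset Printing Implicit Defensive.

Import Order.TTheory GRing.Theory Num.Theory.
Import numFieldNormedType.Exports.

Local Open Scope classical_set_scope.
Local Open Scope ring_scope.

Definition Gamma (R : realType) (s : R) : R :=
  \int[lebesgue_measure]_(t in `]0, +oo[) (t `^ (s - 1) * expR (- t)).

Definition E1 (R : realType) (x : R) : R :=
  \int[lebesgue_measure]_(t in `[x, +oo[) (expR (- t) / t).

Definition Skernel (R : realType) (t : R) : R :=
  expR (- t) * \int[lebesgue_measure]_(s in `]0, +oo[) (t `^ (s - 1) / Gamma s).

(* The kernels are only meaningful for positive arguments; their value at 0,
   reached at the endpoint t = x, does not affect the integrals below. *)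
Definition frac_J (R : realType) (alpha b : R) (f : R -> R) (x : R) : R :=
  alpha^-1 * \int[lebesgue_measure]_(t in `[x, b]) (E1 ((t - x) / alpha) * f t).

Definition frac_S (R : realType) (alpha b : R) (f : R -> R) (x : R) : R :=
  \int[lebesgue_measure]_(t in `[x, b]) (Skernel ((t - x) / alpha) * f t).

Definition abs_continuous (R : realType) (a b : R) (F : R -> R) : Prop :=
  forall e : R, 0 < e -> exists2 d : R, 0 < d &
    forall (n : nat) (u v : 'I_n -> R),
      (forall k, a <= u k /\ u k <= v k /\ v k <= b) ->
      trivIset [set: 'I_n] (fun k => `]u k, v k[%classic) ->
      \sum_(k < n) (v k - u k) < d ->
      \sum_(k < n) `|F (v k) - F (u k)| < e.

Definition ac_rep_of (R : realType) (a b : R) (h F : R -> R) : Prop :=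
  abs_continuous a b F /\
  {ae lebesgue_measure, forall x, x \in `[a, b] -> h x = F x}.

Definition has_ac_rep (R : realType) (a b : R) (h : R -> R) : Prop :=
  exists F : R -> R, ac_rep_of a b h F.

(* Two absolutely continuous representatives agree on [a, b], so the choice
   only matters outside [a, b]; the default h is used when there is none. *)
Definition ac_rep (R : realType) (a b : R) (h : R -> R) : R -> R :=
  xget h [set F | ac_rep_of a b h F].

Definition frac_D (R : realType) (alpha a b : R) (f : R -> R) : R -> R :=
  derive1 (ac_rep a b (frac_J alpha b f)).

(* Elements of L^1 are classes modulo a.e. equality: f is only required to
   agree a.e. on [a, b] with the image of some integrable phi. This implies
   that f is Lebesgue integrable, but not that f itself is Borel measurable. *)
Definition frac_S_L1 (R : realType) (alpha a b : R) : set (R -> R) :=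
  [set f | exists2 phi : R -> R,
     lebesgue_measure.-integrable `[a, b] (EFin \o phi) &
     {ae lebesgue_measure, forall x, x \in `[a, b] -> f x = frac_S alpha b phi x}].

(* Main.v *)
Require Import Defs.
From mathcomp Require Import all_boot all_order all_algebra.
From mathcomp Require Import all_classical all_reals all_analysis.
From mathcomp Require Import measurable_realfun ring lra.

(** The kernels form a Sonine pair.  With [p_s(t) = t^(s-1) e^(-t) / Gamma(s)]
    the densities of the gamma semigroup, [S] is the potential density
    [\int_0^oo p_s ds] and [E1] is the tail of the Levy measure
    [e^(-t)/t dt], so that [E1 * S = 1] on the half-line.  Concretely, let [G_s]
    and [T_h] be the distribution function of [p_s] and the tail of [p_h];
    [p_s * p_h = p_(s+h)] telescopes under [\int_0^oo ds] to
      [(S * T_h)(u) = \int_0^h G_s(u) ds],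
    and multiplying by [Gamma(h) ~ 1/h] and letting [h -> 0] turns the left-hand
    side into [(S * E1)(u)] and the right-hand side into [1].  By Fubini,
    [J_b (S_b phi)(x) = \int_x^b phi], which is absolutely continuous with
    derivative [- phi] almost everywhere, whence [S_b (D_b f) = - S_b phi = - f]. *)

Set Implicit Arguments.
Unset Strict Implicit.
Unset Printing Implicit Defensive.

Import Order.TTheory GRing.Theory Num.Theory.
Import numFieldNormedType.Exports.
Local Open Scope classical_set_scope.
Local Open Scope ring_scope.

(** * Convolution of nonnegative functions on the line *)

(** The obstacle is that the convolution of [S] with [E1] is not known to be finite beforehand, so
    the limit [h -> 0] cannot rest on domination. Every convolution is therefore taken between
    nonnegative functions with values in [\bar R], where Tonelli asks only for measurability, and
    the limit becomes two inequalities. From above, [t^h >= min(w,1)^h] for [t >= w], and this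
    factor increases to 1 as [h] decreases, so monotone convergence applies. From below,
    [t^h <= 1 + h t^2] leaves an additive error [h * Gamma 2], harmless because [convol gpot] of the
    half-line indicator is finite. That finiteness comes from the decay in [s] of the Laplace
    transform [2^-s] of the gamma law, and it also legitimates the cancellation in the telescoping.
    The beta integral behind [p_s * p_h = p_(s+h)] is never evaluated: comparing total masses
    determines it. In the inversion, the integrability required by Fubini is supplied by the Sonine
    identity itself. *)

Lemma pushforward_affine {R : realType} (c d : R) : c != 0 ->
  forall A, measurable A ->
  lebesgue_measure A =
  (`|c|%:E * lebesgue_measure ((fun x : R => (c * x + d)%R) @^-1` A))%E.
Proof.
move=> c0.
have mphi : measurable_fun setT
    ((fun x => (c * x + d)%R) : measurableTypeR R -> measurableTypeR R).
  by apply: measurable_funD => //; exact: measurable_funM.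
have c_ge0 : (0 <= `|c|)%R by [].
move=> A mA.
pose nu : {measure set (measurableTypeR R) -> \bar R} :=
  measure_function_pushforward__canonical__measure_function_Measure
    (@lebesgue_measure R) mphi.
change (lebesgue_measure A = mscale (NngNum c_ge0) nu A).
(* It suffices to compare half-open intervals. For [c < 0] the preimage of []x, y]] is closed on the
   left and open on the right, hence the two cases. *)
apply: lebesgue_measure_unique => // _ [[x y] _ <-].
rewrite /= /mscale /pushforward /=.
case: (ltgtP c 0) c0 => // [clt0|cgt0] _.
- rewrite [X in (_ * lebesgue_measure X)%E](_ : _ =
            `[((y - d) / c)%R, ((x - d) / c)%R[%classic); last first.
    apply/seteqP; split => z /=; rewrite !in_itv/= ler_ndivrMr// ltr_ndivlMr//;
      by rewrite lerBrDr ltrBlDr (mulrC z) andbC.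
  rewrite !lebesgue_measure_itv/= !lte_fin.
  rewrite ltr_ndivlMr// divfK ?lt_eqF// ltrBlDr subrK.
  case: ifPn => _; last by rewrite mule0.
  rewrite -!EFinB -EFinM ltr0_norm// -mulrBl mulrCA mulNr divff ?lt_eqF//.
  by congr EFin; ring.
- rewrite [X in (_ * lebesgue_measure X)%E](_ : _ =
            `]((x - d) / c)%R, ((y - d) / c)%R]%classic); last first.
    apply/seteqP; split => z /=; rewrite !in_itv/= ler_pdivlMr// ltr_pdivrMr//;
      by rewrite lerBrDr ltrBlDr (mulrC z).
  rewrite !lebesgue_measure_itv/= !lte_fin.
  rewrite ltr_pdivrMr// divfK ?gt_eqF// ltrBlDr subrK.
  case: ifPn => _; last by rewrite mule0.
  rewrite -!EFinB -EFinM gtr0_norm// -mulrBl mulrCA divff ?gt_eqF//.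
  by congr EFin; ring.
Qed.

(** This is a change of measure, so plain measurability of [f] is enough. It provides the
    translations, dilations and the reflection used below. *)
Lemma ge0_integral_affine {R : realType} (c d : R) (f : R -> \bar R) :
  c != 0 -> measurable_fun setT f -> (forall x, 0 <= f x)%E ->
  (\int[lebesgue_measure]_x f x =
   `|c|%:E * \int[lebesgue_measure]_x f (c * x + d)%R)%E.
Proof.
move=> c0 mf f0.
have mphi : measurable_fun setT
    ((fun x => (c * x + d)%R) : measurableTypeR R -> measurableTypeR R).
  by apply: measurable_funD => //; exact: measurable_funM.
have c_ge0 : (0 <= `|c|)%R by [].
pose nu : {measure set (measurableTypeR R) -> \bar R} :=
  measure_function_pushforward__canonical__measure_function_Measure
    (@lebesgue_measure R) mphi.
transitivity (\int[mscale (NngNum c_ge0) nu]_x f x)%E.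
  by apply: eq_measure_integral => A mA _; exact: pushforward_affine.
rewrite ge0_integral_mscale//; congr (_ * _)%E.
by rewrite ge0_integral_pushforward.
Qed.

(** The integral runs over the whole line; support on the half-line is carried by factors [pos],
    which avoids variable bounds of integration. *)
Definition convol {R : realType} (f g : R -> \bar R) (x : R) : \bar R :=
  (\int[lebesgue_measure]_y (f y * g (x - y)%R))%E.

Section convolution.
Context {R : realType}.
Local Open Scope ereal_scope.
Local Notation mu := (@lebesgue_measure R).
Implicit Types f g h : R -> \bar R.

Lemma lebesgue_tonelli (f : R -> R -> \bar R) :
  measurable_fun setT (fun z : R * R => f z.1 z.2) -> (forall x y, 0 <= f x y) ->
  \int[mu]_x \int[mu]_y f x y = \int[mu]_y \int[mu]_x f x y.
Proof.
by move=> mf f0; exact: (fubini_tonelli (m1 := mu) (m2 := mu)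
  (fun z : R * R => f z.1 z.2)).
Qed.

Lemma convol_ge0 f g x : (forall x, 0 <= f x) -> (forall x, 0 <= g x) ->
  0 <= convol f g x.
Proof. by move=> f0 g0; apply: integral_ge0 => y _; exact: mule_ge0. Qed.

Lemma measurable_convol_integrand f g (x : R) :
  measurable_fun setT f -> measurable_fun setT g ->
  measurable_fun setT (fun y => f y * g (x - y)%R).
Proof.
move=> mf mg; apply: emeasurable_funM => //; apply: measurableT_comp => //.
exact: measurable_funB.
Qed.

Lemma measurable_convol f g :
  measurable_fun setT f -> measurable_fun setT g ->
  (forall x, 0 <= f x) -> (forall x, 0 <= g x) ->
  measurable_fun setT (convol f g).
Proof.
move=> mf mg f0 g0.
apply: (measurable_fun_fubini_tonelli_F (m2 := mu)
  (fun z : R * R => f z.2 * g (z.1 - z.2)%R)).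
- apply: emeasurable_funM; first exact: measurableT_comp.
  by apply: measurableT_comp => //; exact: measurable_funB.
- by move=> z; exact: mule_ge0.
Qed.

Lemma le_convol f g h x : measurable_fun setT f ->
  measurable_fun setT g -> measurable_fun setT h ->
  (forall x, 0 <= f x) -> (forall x, 0 <= g x) -> (forall x, g x <= h x) ->
  convol f g x <= convol f h x.
Proof.
move=> mf mg mh f0 g0 gh; apply: ge0_le_integral => //.
- by move=> y _; exact: mule_ge0.
- exact: measurable_convol_integrand.
- exact: measurable_convol_integrand.
- by move=> y _; exact: lee_wpmul2l.
Qed.

Lemma convolDr f g h x : measurable_fun setT f ->
  measurable_fun setT g -> measurable_fun setT h ->
  (forall x, 0 <= f x) -> (forall x, 0 <= g x) -> (forall x, 0 <= h x) ->
  convol f (g \+ h) x = convol f g x + convol f h x.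
Proof.
move=> mf mg mh f0 g0 h0; rewrite /convol -ge0_integralD//.
- by apply: eq_integral => y _; rewrite ge0_muleDr.
- by move=> y _; exact: mule_ge0.
- exact: measurable_convol_integrand.
- by move=> y _; exact: mule_ge0.
- exact: measurable_convol_integrand.
Qed.

Lemma convolZr f g (c : R) x : measurable_fun setT f -> measurable_fun setT g ->
  (forall x, 0 <= f x) -> (forall x, 0 <= g x) -> (0 <= c)%R ->
  convol f (fun y => c%:E * g y) x = c%:E * convol f g x.
Proof.
move=> mf mg f0 g0 c0; rewrite /convol -ge0_integralZl//.
- by apply: eq_integral => y _; rewrite muleCA.
- exact: measurable_convol_integrand.
- by move=> y _; exact: mule_ge0.
Qed.

(** Tonelli, then the translation [w = z + y] in the inner integral. *)
Lemma convolA f g h x : measurable_fun setT f ->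
  measurable_fun setT g -> measurable_fun setT h ->
  (forall x, 0 <= f x) -> (forall x, 0 <= g x) -> (forall x, 0 <= h x) ->
  convol (convol f g) h x = convol f (convol g h) x.
Proof.
move=> mf mg mh f0 g0 h0.
transitivity (\int[mu]_w \int[mu]_y (f y * g (w - y)%R * h (x - w)%R)).
  apply: eq_integral => w _; rewrite /convol -ge0_integralZr//.
  - exact: measurable_convol_integrand.
  - by move=> y _; exact: mule_ge0.
rewrite lebesgue_tonelli; last 2 first.
- apply: emeasurable_funM; last first.
    by apply: measurableT_comp => //; exact: measurable_funB.
  apply: emeasurable_funM; first exact: measurableT_comp.
  by apply: measurableT_comp => //; exact: measurable_funB.
- by move=> w y; rewrite !mule_ge0.
apply: eq_integral => y _ /=.
have mgh : measurable_fun setT (fun w : R => g (w - y)%R * h (x - w)%R).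
  apply: emeasurable_funM; apply: measurableT_comp => //;
    exact: measurable_funB.
under eq_integral do rewrite -muleA.
rewrite ge0_integralZl//; last by move=> w _; exact: mule_ge0.
congr (_ * _); rewrite /convol.
rewrite (@ge0_integral_affine R 1 y _ _ mgh) ?oner_neq0//; last first.
  by move=> w; exact: mule_ge0.
rewrite normr1 mul1e; apply: eq_integral => z _.
by congr (g _ * h _); ring.
Qed.

End convolution.

(** * Gamma function *)

Definition pos {R : realType} (t : R) : R := \1_(`]0, +oo[%classic : set R) t.

(* [t^(s-1) e^(-t)] on [t > 0], as a single exponential so that joint
   measurability in [(s, t)] is immediate; [gker 0] is the integrand of [E1]. *)
Definition gker {R : realType} (s t : R) : R :=
  pos t * expR ((s - 1) * ln t - t).

Section gamma.
Context {R : realType}.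
Local Notation mu := (@lebesgue_measure R).
Implicit Types s t T : R.

Lemma posE t : pos t = (0 < t)%R%:R.
Proof. by rewrite /pos indicE mem_setE in_itv/= andbT. Qed.

Lemma pos_ge0 t : 0 <= pos t.
Proof. by rewrite posE ler0n. Qed.

Lemma measurable_pos : measurable_fun setT (@pos R).
Proof. exact: measurable_indic. Qed.

Lemma gker_powR s t : gker s t = pos t * (t `^ (s - 1) * expR (- t)).
Proof.
rewrite /gker posE; case: ltP => [t0|_]; last by rewrite !mul0r.
by rewrite expRD /powR gt_eqF.
Qed.

Lemma gker_ge0 s t : 0 <= gker s t.
Proof. by rewrite mulr_ge0 ?pos_ge0 ?expR_ge0. Qed.

Lemma measurable_gker2 : measurable_fun setT (fun z : R * R => gker z.1 z.2).
Proof.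
apply: measurable_funM; first exact: measurableT_comp measurable_pos _.
apply: measurableT_comp => //; apply: measurable_funB => //.
apply: measurable_funM; first exact: measurable_funB.
by apply: measurableT_comp => //; exact: measurable_ln.
Qed.

Lemma measurable_gker s : measurable_fun setT (gker s).
Proof. exact: measurableT_comp measurable_gker2 (measurable_pair1 s). Qed.

Lemma integral_mkpos (f : R -> R) :
  (\int[mu]_(t in `]0%R, +oo[) (f t)%:E = \int[mu]_t (pos t * f t)%:E)%E.
Proof.
rewrite integral_mkcond; apply: eq_integral => t _.
by rewrite patchE /pos indicE; case: ifPn => _; rewrite ?mul1r ?mul0r.
Qed.

Lemma GammaE s : Gamma s = fine (\int[mu]_t (gker s t)%:E).
Proof.
rewrite /Gamma /Rintegral integral_mkpos; congr fine.
by apply: eq_integral => t _; rewrite gker_powR.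
Qed.

(** For [s < 1] the integrand is unbounded at 0, so the primitive [t^s / s] is used on compact
    intervals exhausting []0, 1]]. *)
Lemma integral_powR01 s : 0 < s ->
  (\int[mu]_(t in `]0%R, 1%R]) (t `^ (s - 1))%:E = s^-1%:E)%E.
Proof.
move=> s0.
(* The shift by 2 keeps the left endpoint strictly below 1, as [continuous_FTC2] requires. *)
pose S n : set R := `[n.+2%:R^-1, 1]%classic.
have -> : `]0%R, 1%R]%classic = \bigcup_n S n.
  apply/seteqP; split => t /=; rewrite in_itv/=.
    move=> /andP[t0 t1]; exists (Num.truncn t^-1) => //; rewrite /S /= in_itv/= t1 andbT.
    rewrite invf_ple ?posrE//; apply: ltW; apply: lt_trans (truncnS_gt _) _.
    by rewrite ltr_nat.
  move=> [n _]; rewrite /S /= in_itv/= => /andP[nt ->]; rewrite andbT.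
  by apply: lt_le_trans nt; rewrite invr_gt0.
have mf : measurable_fun setT (fun t : R => (t `^ (s - 1))%:E).
  by apply/measurable_EFinP; exact: measurable_powR.
have H : (\int[mu]_(t in S n) (t `^ (s - 1))%:E)%E @[n --> \oo] -->
    (\int[mu]_(t in \bigcup_n S n) (t `^ (s - 1))%:E)%E.
  apply: ge0_nondecreasing_set_cvg_integral => //.
  - by apply/nondecreasing_seqP => n; apply/subsetPset => t; rewrite /S /=;
      rewrite !in_itv/= => /andP[nt ->]; rewrite andbT; apply: le_trans nt;
      rewrite lef_pV2 ?posrE// ler_nat.
  - by move=> n; exact: measurable_itv.
  - by move=> n; exact: measurable_funTS.
  - by move=> n t _; rewrite lee_fin powR_ge0.
rewrite -(cvg_lim _ H)//; apply/cvg_lim => //.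
have E n : (\int[mu]_(t in S n) (t `^ (s - 1))%:E)%E =
    (s^-1 - n.+2%:R^-1 `^ s / s)%:E.
  have n0 : 0 < n.+2%:R^-1 :> R by rewrite invr_gt0.
  rewrite (@continuous_FTC2 _ _ (fun t => t `^ s / s)).
  - by rewrite powR1 mul1r EFinB.
  - by rewrite invf_lt1// ltr1n.
  - apply: derivable_within_continuous => t; rewrite in_itv/= => /andP[nt _].
    by apply: derivable_powR; rewrite in_itv/= andbT (lt_le_trans n0).
  - have dF t : 0 < t -> derivable (fun t : R => t `^ s / s) t 1.
      by move=> t0; apply: derivableM => //; apply: derivable_powR;
        rewrite in_itv/= andbT.
    have cF t : 0 < t -> {for t, continuous (fun t : R => t `^ s / s)}.
      by move=> /dF /derivable1_diffP /differentiable_continuous.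
    split.
    + by move=> t; rewrite in_itv/= => /andP[nt _]; exact/dF/(lt_trans n0).
    + exact/cvg_at_right_filter/cF.
    + exact/cvg_at_left_filter/cF.
  - move=> t; rewrite in_itv/= => /andP[nt _].
    have t0 : t \in `]0, +oo[ by rewrite in_itv/= andbT (lt_trans n0).
    rewrite derive1Mr ?powR_derive1//; last exact: derivable_powR.
    by rewrite mulrAC divff ?mul1r// gt_eqF.
under eq_fun do rewrite E.
apply: cvg_EFin; first exact: nearW.
rewrite -[X in _ --> X]subr0; apply: cvgB; first exact: cvg_cst.
rewrite -(mul0r s^-1); apply: cvgM; last exact: cvg_cst.
move/cvg_at_rightP : (powR_cvg0 s0); apply; split => [n|].
  by rewrite invr_gt0.
rewrite (_ : (fun n => n.+2%:R^-1) = [sequence harmonic n.+1]_n)//.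
by rewrite (cvg_shiftS (harmonic : nat -> R)); exact: cvg_harmonic.
Qed.

Lemma integral_powR01_indic s : 0 < s ->
  (\int[mu]_t (\1_(`]0, 1]%classic : set R) t * t `^ (s - 1))%:E = s^-1%:E)%E.
Proof.
move=> s0; rewrite -integral_powR01// [RHS]integral_mkcond.
apply: eq_integral => t _; rewrite patchE indicE.
by case: ifPn => _; rewrite ?mul1r ?mul0r.
Qed.

(** The majorant treats the two ends separately: the power has mass [s^-1] near 0, the exponential
    density has mass 1. It yields both the finiteness of [Gamma] and its upper bound near 0. *)
Lemma integral_powR_exp_bound s K r (g : R -> R) : 0 < s -> 0 <= K -> 0 < r ->
  measurable_fun setT g -> (forall t, 0 <= g t) ->
  (forall t, g t <= \1_(`]0, 1]%classic : set R) t * t `^ (s - 1) +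
                    K * exponential_pdf r t) ->
  (\int[mu]_t (g t)%:E <= (s^-1 + K)%:E)%E.
Proof.
move=> s0 K0 r0 mg g0 gle.
have mE : measurable_fun setT (fun t => (exponential_pdf r t)%:E).
  by apply/measurable_EFinP; exact: measurable_exponential_pdf.
have E0 t : (0 <= (exponential_pdf r t)%:E)%E.
  by rewrite lee_fin exponential_pdf_ge0// ltW.
have mP : measurable_fun setT
    (fun t : R => (\1_(`]0, 1]%classic : set R) t * t `^ (s - 1))%:E).
  apply/measurable_EFinP; apply: measurable_funM; first exact: measurable_indic.
  exact: measurable_powR.
rewrite EFinD -integral_powR01_indic//.
rewrite -[X in (_ + X)%E]mule1 -(integral_exponential_pdf r0).
rewrite -ge0_integralZl// -?ge0_integralD//.
- apply: ge0_le_integral => //.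
  + by move=> t _; rewrite lee_fin.
  + exact/measurable_EFinP.
  + by apply: emeasurable_funD => //; exact: measurable_funeM.
  + by move=> t _; rewrite -EFinM -EFinD lee_fin.
- by move=> t _; rewrite lee_fin mulr_ge0// powR_ge0.
- by move=> t _; exact: mule_ge0.
- exact: measurable_funeM.
Qed.

Lemma integral_gker_lty s : 0 < s -> (\int[mu]_t (gker s t)%:E < +oo)%E.
Proof.
(* For [t > 1], [ln t <= t / (2 * s) + ln (2 * s)] gives [(s - 1) * ln t - t <= s * ln (2 * s) - t /
   2]. The factor 2 cancels the rate [2^-1] of the exponential density. *)
move=> s0; pose K := 2 * expR (s * ln (2 * s)).
have K0 : 0 <= K by rewrite mulr_ge0 ?expR_ge0.
apply: le_lt_trans (ltry (s^-1 + K)).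
apply: (@integral_powR_exp_bound s K 2^-1) => //.
- exact: measurable_gker.
- exact: gker_ge0.
move=> t; rewrite gker_powR posE indicE mem_setE in_itv/=.
have E0 : 0 <= exponential_pdf 2^-1 t :> R by exact: exponential_pdf_ge0.
case: (ltP 0 t) => t0 /=; last by rewrite !mul0r add0r mulr_ge0.
rewrite mul1r; case: (leP t 1) => t1.
  rewrite mul1r (@le_trans _ _ (t `^ (s - 1)))//.
    by rewrite ler_piMr ?powR_ge0// -expR0 ler_expR oppr_le0 ltW.
  by rewrite lerDl mulr_ge0.
rewrite mul0r add0r exponential_pdfE ?(ltW t0)//.
rewrite {1}/powR gt_eqF// -expRD /K mulrACA (mulrC 2) mulVf// mul1r -expRD.
rewrite ler_expR.
have lnt : ln t <= t / (2 * s) + ln (2 * s).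
  have s20 : 0 < 2 * s by rewrite mulr_gt0.
  have ts0 : 0 < t / (2 * s) by rewrite divr_gt0.
  have := lnM ts0 s20; rewrite divfK ?gt_eqF// => ->.
  by rewrite lerD2r ltW// ln_sublinear.
have lnt0 : 0 <= ln t by rewrite ln_ge0// ltW.
have : s * ln t <= s * (t / (2 * s) + ln (2 * s)) by rewrite ler_pM2l.
have -> : s * (t / (2 * s) + ln (2 * s)) = t / 2 + s * ln (2 * s).
  by field; rewrite gt_eqF.
by lra.
Qed.

Lemma integral_gker s : 0 < s -> (\int[mu]_t (gker s t)%:E = (Gamma s)%:E)%E.
Proof.
move=> s0; rewrite GammaE fineK// ge0_fin_numE ?integral_gker_lty//.
by apply: integral_ge0 => t _; rewrite lee_fin gker_ge0.
Qed.

(** Only [[T, T + 1]] is kept from the integral. As [T] is free, [Gamma s] dominates every geometric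
    growth in [s]; [T = 1] gives positivity. *)
Lemma Gamma_lower_bound s T : 0 < s -> 0 < T ->
  T `^ s / (T + 1) * expR (- (T + 1)) <= Gamma s.
Proof.
move=> s0 T0; rewrite -lee_fin -integral_gker//.
set c := (X in (X%:E <= _)%E).
have c0 : 0 <= c.
  by rewrite mulr_ge0 ?expR_ge0// divr_ge0 ?powR_ge0// addr_ge0// ltW.
pose D : set R := `[T, T + 1]%classic.
have mD : measurable D by exact: measurable_itv.
have -> : (c%:E = \int[mu]_(t in D) (cst c%:E t))%E.
  rewrite integral_cst//= /D lebesgue_measure_itv/= lte_fin ltrDl ltr01.
  by rewrite -EFinB addrAC subrr add0r mule1.
have mg : measurable_fun setT (fun t => (gker s t)%:E).
  by apply/measurable_EFinP; exact: measurable_gker.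
apply: (@le_trans _ _ (\int[mu]_(t in D) (gker s t)%:E)%E).
  apply: ge0_le_integral => //; first by apply: measurable_funTS.
  move=> t; rewrite /D /= in_itv/= => /andP[Tt tT].
  have t0 : 0 < t by exact: lt_le_trans Tt.
  rewrite lee_fin gker_powR posE t0 mul1r.
  have -> : t `^ (s - 1) = t `^ s / t.
    by rewrite -(mulr_powRB1 (ltW t0) s0) mulrAC divff ?mul1r// gt_eqF.
  have T10 : 0 < T + 1 by rewrite addr_gt0.
  apply: ler_pM; last by rewrite ler_expR lerN2.
  - by rewrite divr_ge0 ?powR_ge0// ltW.
  - by rewrite expR_ge0.
  apply: ler_pM; last by rewrite lef_pV2.
  - by rewrite powR_ge0.
  - by rewrite invr_ge0 ltW.
  - by apply: ge0_ler_powR => //; rewrite ?nnegrE ltW.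
by apply: ge0_subset_integral => // t _; rewrite lee_fin gker_ge0.
Qed.

Lemma Gamma_gt0 s : 0 < s -> 0 < Gamma s.
Proof.
move=> s0; apply: lt_le_trans (Gamma_lower_bound s0 ltr01).
by rewrite mulr_gt0 ?expR_gt0// divr_gt0// powR_gt0.
Qed.

(** With [Gamma_ge_near0], this is the quantitative form of [Gamma h ~ 1/h]: [h * Gamma h] lies
    between [1 - h] and [1 + h] for [0 < h <= 1]. *)
Lemma Gamma_le_near0 s : 0 < s -> s <= 1 -> Gamma s <= s^-1 + 1.
Proof.
move=> s0 s1; rewrite -lee_fin -integral_gker//.
apply: (@integral_powR_exp_bound s 1 1) => //.
- exact: measurable_gker.
- exact: gker_ge0.
move=> t; rewrite gker_powR posE indicE mem_setE in_itv/=.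
have E0 : 0 <= exponential_pdf 1 t :> R by exact: exponential_pdf_ge0.
case: (ltP 0 t) => t0 /=; last by rewrite !mul0r add0r mulr_ge0.
rewrite !mul1r; case: (leP t 1) => t1.
  rewrite mul1r (@le_trans _ _ (t `^ (s - 1)))//.
    by rewrite ler_piMr ?powR_ge0// -expR0 ler_expR oppr_le0 ltW.
  by rewrite lerDl.
rewrite mul0r add0r exponential_pdfE ?(ltW t0)// mul1r mulN1r.
rewrite ler_piMl ?expR_ge0// /powR gt_eqF// -[leRHS]expR0 ler_expR.
have lnt0 : 0 <= ln t by rewrite ln_ge0// ltW.
by nra.
Qed.

(** On []0, 1]], [expR (- t) >= 1 - t] bounds the integral below by [s^-1 - (s + 1)^-1]. The
    subtracted term is moved to the other side so that all integrands stay nonnegative. *)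
Lemma Gamma_ge_near0 s : 0 < s -> s^-1 - 1 <= Gamma s.
Proof.
move=> s0; have s10 : 0 < s + 1 by rewrite addr_gt0.
suff : s^-1 <= Gamma s + (s + 1)^-1.
  have : (s + 1)^-1 <= 1 by rewrite invf_le1// lerDr ltW.
  by lra.
rewrite -lee_fin EFinD -integral_gker// -!integral_powR01_indic//.
have mP r : measurable_fun setT
    (fun t : R => (\1_(`]0, 1]%classic : set R) t * t `^ (r - 1))%:E).
  apply/measurable_EFinP; apply: measurable_funM; first exact: measurable_indic.
  exact: measurable_powR.
have mg : measurable_fun setT (fun t => (gker s t)%:E).
  by apply/measurable_EFinP; exact: measurable_gker.
have P0 r t : (0 <= (\1_(`]0, 1]%classic : set R) t * t `^ (r - 1))%:E)%E.
  by rewrite lee_fin mulr_ge0// powR_ge0.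
have g0 t : (0 <= (gker s t)%:E)%E by rewrite lee_fin gker_ge0.
rewrite -ge0_integralD//; last exact: (mP (s + 1)).
apply: ge0_le_integral => //; first exact: (mP s).
  by apply: emeasurable_funD => //; exact: (mP (s + 1)).
move=> t _; rewrite -EFinD lee_fin gker_powR posE indicE mem_setE in_itv/=.
case: (ltP 0 t) => t0 /=; last by rewrite !mul0r addr0.
case: (leP t 1) => t1 /=; last by rewrite !mul0r addr0 mul1r mulr_ge0 ?powR_ge0 ?expR_ge0.
rewrite !mul1r -addrA subrr addr0 -(mulr_powRB1 (ltW t0) s0).
rewrite (mulrC t) -mulrDr ler_peMr ?powR_ge0//.
by have := expR_ge1Dx (- t); lra.
Qed.

End gamma.

(** * Gamma semigroup *)

(* [gker s t / Gamma s] for [s > 0], with [1 / Gamma] inside the exponential for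
   the sake of measurability in [s]. *)
Definition gdens {R : realType} (s t : R) : R :=
  pos t * expR ((s - 1) * ln t - t - ln (Gamma s)).

(** The distribution function is written as a convolution so that the semigroup law passes to it by
    associativity. *)
Definition gcdf {R : realType} (s u : R) : \bar R :=
  convol (fun t => (gdens s t)%:E) (fun t => (pos t)%:E) u.

Section gamma_semigroup.
Context {R : realType}.
Local Open Scope ereal_scope.
Local Notation mu := (@lebesgue_measure R).
Implicit Types s h t u : R.

Lemma posM s t : (0 < s)%R -> pos (s * t)%R = pos t.
Proof. by move=> s0; rewrite !posE pmulr_rgt0. Qed.

Lemma pos_le1 t : (pos t <= 1)%R.
Proof. by rewrite posE; case: (_ < _)%R. Qed.

Lemma gdensE s t : (0 < s)%R -> gdens s t = (gker s t / Gamma s)%R.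
Proof.
move=> s0; rewrite /gdens /gker -mulrA expRD expRN lnK// posrE.
exact: Gamma_gt0.
Qed.

Lemma gdens_ge0 s t : 0 <= (gdens s t)%:E.
Proof. by rewrite lee_fin mulr_ge0 ?pos_ge0 ?expR_ge0. Qed.

Lemma epos_ge0 t : 0 <= (pos t)%:E.
Proof. by rewrite lee_fin pos_ge0. Qed.

Lemma measurable_epos : measurable_fun setT (fun t : R => (pos t)%:E).
Proof. by apply/measurable_EFinP; exact: measurable_pos. Qed.

Lemma measurable_Gamma : measurable_fun setT (@Gamma R).
Proof.
rewrite (_ : @Gamma R = fine \o (fun s => \int[mu]_t (gker s t)%:E)).
  apply: measurableT_comp => //.
  apply: (measurable_fun_fubini_tonelli_F (m2 := mu)
    (fun z : R * R => (gker z.1 z.2)%:E)).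
    by apply/measurable_EFinP; exact: measurable_gker2.
  by move=> z; rewrite lee_fin gker_ge0.
by apply/funext => s; rewrite GammaE.
Qed.

Lemma measurable_gdens2 : measurable_fun setT (fun z : R * R => gdens z.1 z.2).
Proof.
apply: measurable_funM; first exact: measurableT_comp measurable_pos _.
apply: measurableT_comp => //; apply: measurable_funB.
  apply: measurable_funB => //.
  apply: measurable_funM; first exact: measurable_funB.
  by apply: measurableT_comp => //; exact: measurable_ln.
apply: (measurableT_comp (@measurable_ln R)).
exact: (measurableT_comp measurable_Gamma).
Qed.

Lemma measurable_gdens s : measurable_fun setT (fun t => (gdens s t)%:E).
Proof.
apply/measurable_EFinP.
exact: measurableT_comp measurable_gdens2 (measurable_pair1 s).
Qed.

Lemma integral_gdens s : (0 < s)%R -> \int[mu]_t (gdens s t)%:E = 1.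
Proof.
move=> s0; under eq_integral do rewrite gdensE// EFinM.
rewrite ge0_integralZr//.
- rewrite integral_gker// -EFinM divff// gt_eqF//; exact: Gamma_gt0.
- by apply/measurable_EFinP; exact: measurable_gker.
- by move=> t _; rewrite lee_fin gker_ge0.
- by rewrite lee_fin invr_ge0 ltW// Gamma_gt0.
Qed.

(** The Laplace transform of the gamma law at 1, equal to [2^-s]: replacing [t] by [t / 2] absorbs
    the extra exponential. *)
Lemma integral_gdens_exp s : (0 < s)%R ->
  \int[mu]_t (gdens s t * expR (- t))%:E = (expR (- (s * ln 2)))%:E.
Proof.
move=> s0.
have i2 : (2^-1 != 0 :> R)%R by rewrite invr_eq0.
rewrite (@ge0_integral_affine R 2^-1 0)//; last 2 first.
- apply/measurable_EFinP; apply: measurable_funM.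
    by apply/measurable_EFinP; exact: measurable_gdens.
  by apply: measurableT_comp => //; exact: measurable_funN.
- by move=> t; rewrite EFinM mule_ge0 ?gdens_ge0// lee_fin expR_ge0.
transitivity (`|2^-1|%:E *
    \int[mu]_t ((expR (- ((s - 1) * ln 2)))%:E * (gdens s t)%:E)).
  congr (_ * _); apply: eq_integral => t _.
  rewrite addr0 -EFinM; congr EFin.
  rewrite /gdens posM// posE; case: ltP => t0; last by rewrite !mul0r mulr0.
  rewrite !mul1r -!expRD; congr expR.
  have -> : ln (2^-1 * t)%R = (ln t - ln 2)%R.
    by rewrite mulrC ln_div// posrE.
  by field.
rewrite ge0_integralZl//; last 2 first.
- exact: measurable_gdens.
- by move=> t _; exact: gdens_ge0.
rewrite integral_gdens// mule1 -EFinM; congr EFin.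
rewrite gtr0_norm ?invr_gt0// -{1}(@lnK R 2%R) ?posrE// -expRN -expRD.
by congr expR; ring.
Qed.

Lemma convol_cst1 (f : R -> \bar R) u : convol f (cst 1) u = \int[mu]_t f t.
Proof. by apply: eq_integral => t _; rewrite mule1. Qed.

(** The unnormalized beta density on []0, 1[]. *)
Let beta_kernel s h x : R :=
  (pos x * pos (1 - x) * expR ((s - 1) * ln x + (h - 1) * ln (1 - x)))%R.

Let measurable_beta_kernel s h : measurable_fun setT (fun x => (beta_kernel s h x)%:E).
Proof.
have mB : measurable_fun setT (fun x : R => 1 - x)%R by exact: measurable_funB.
apply/measurable_EFinP; apply: measurable_funM.
  apply: measurable_funM; first exact: measurable_pos.
  exact: measurableT_comp measurable_pos mB.
apply: measurableT_comp => //; apply: measurable_funD; apply: measurable_funM => //.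
exact: (measurableT_comp (@measurable_ln R) mB).
Qed.

(** After [y = r * x] the two exponentials combine into [expR (- r)] and the powers of [r] factor
    out, leaving a constant independent of [r]. For [r <= 0] both sides vanish. *)
Let convol_gker s h r :
  convol (fun t => (gker s t)%:E) (fun t => (gker h t)%:E) r =
  (gker (s + h) r)%:E * \int[mu]_x (beta_kernel s h x)%:E.
Proof.
have mq q : measurable_fun setT (fun t => (gker q t)%:E).
  by apply/measurable_EFinP; exact: measurable_gker.
have q0 q t : 0 <= (gker q t)%:E by rewrite lee_fin gker_ge0.
have [r0|r0] := ltP 0%R r; last first.
  rewrite [in RHS]/gker [in RHS]posE ltNge r0 mul0r mul0e.
  apply: integral0_eq => y _; rewrite -EFinM /gker !posE subr_gt0.
  case: ltP => y0; last by rewrite !mul0r.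
  by rewrite ltNge (le_trans r0 (ltW y0)) mul0r mulr0.
rewrite /convol (@ge0_integral_affine R r 0) ?gt_eqF//; last 2 first.
- exact: (measurable_convol_integrand r (mq s) (mq h)).
- by move=> y; exact: mule_ge0.
have mb := measurable_beta_kernel s h.
have b0 x : 0 <= (beta_kernel s h x)%:E.
  by rewrite lee_fin !mulr_ge0 ?pos_ge0 ?expR_ge0.
have mI : measurable_fun setT
    (fun x => (gker s (r * x + 0))%:E * (gker h (r - (r * x + 0)))%:E).
  have maff : measurable_fun setT (fun x : R => r * x + 0)%R.
    by apply: measurable_funD => //; exact: measurable_funM.
  exact: (measurableT_comp (measurable_convol_integrand r (mq s) (mq h)) maff).
rewrite gtr0_norm// -ge0_integralZl//; last 2 first.
- by move=> x _; exact: mule_ge0.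
- by rewrite lee_fin ltW.
rewrite -ge0_integralZl//.
apply: eq_integral => x _; rewrite -!EFinM; congr EFin.
rewrite addr0 /beta_kernel /gker.
have -> : (r - r * x = r * (1 - x))%R by ring.
rewrite !posM// !posE r0.
case: (ltP 0%R x) => x0; last by rewrite !(mul0r, mulr0).
case: ltP => x1; last by rewrite !(mul0r, mulr0).
rewrite !mul1r -{1}(@lnK R r) ?posrE// -!expRD; congr expR.
by rewrite !lnM ?posrE//; ring.
Qed.

Lemma convol_gdens s h r : (0 < s)%R -> (0 < h)%R ->
  convol (fun t => (gdens s t)%:E) (fun t => (gdens h t)%:E) r =
  (gdens (s + h) r)%:E.
Proof.
move=> s0 h0; have sh0 : (0 < s + h)%R by rewrite addr_gt0.
have mq q : measurable_fun setT (fun t => (gker q t)%:E).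
  by apply/measurable_EFinP; exact: measurable_gker.
have q0 q t : 0 <= (gker q t)%:E by rewrite lee_fin gker_ge0.
set B := \int[mu]_x (beta_kernel s h x)%:E.
have B0 : 0 <= B.
  by apply: integral_ge0 => x _; rewrite lee_fin !mulr_ge0 ?pos_ge0 ?expR_ge0.
(* Total masses multiply under convolution: this is associativity with the constant 1 as third
   factor. *)
have BE : (Gamma (s + h))%:E * B = (Gamma s * Gamma h)%:E.
  have := @convolA R _ _ (cst 1) 0 (mq s) (mq h) (measurable_cst _)
    (q0 s) (q0 h) (fun=> lee01).
  rewrite convol_cst1 (_ : convol (fun t => (gker h t)%:E) (cst 1) =
    fun=> (Gamma h)%:E); last first.
    by apply/funext => u; rewrite convol_cst1 integral_gker.
  have -> : convol (fun t => (gker s t)%:E) (fun t => (gker h t)%:E) =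
      (fun t => (gker (s + h) t)%:E * B).
    by apply/funext => u; exact: convol_gker.
  rewrite ge0_integralZr//; last exact: mq.
  have Gh : 0 <= (Gamma h)%:E by rewrite lee_fin ltW// Gamma_gt0.
  rewrite integral_gker// => ->; rewrite /convol ge0_integralZr//.
    by rewrite integral_gker.
  exact: mq.
have G0 (q : R) : (0 < q)%R -> (Gamma q != 0)%R.
  by move=> /Gamma_gt0; rewrite lt0r => /andP[].
transitivity ((Gamma s * Gamma h)^-1%:E *
    convol (fun t => (gker s t)%:E) (fun t => (gker h t)%:E) r).
  rewrite /convol -ge0_integralZl//.
  - apply: eq_integral => y _; rewrite !gdensE// -!EFinM; congr EFin.
    by field; rewrite !G0.
  - exact: (measurable_convol_integrand r (mq s) (mq h)).
  - by move=> y _; exact: mule_ge0.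
  - by rewrite lee_fin invr_ge0 mulr_ge0// ltW// Gamma_gt0.
rewrite convol_gker -/B muleA -EFinM gdensE//.
(* An infinite [B] is excluded because [Gamma s * Gamma h] is finite and [Gamma (s + h)] is
   positive. *)
case: B B0 BE => [b _|_|//].
  rewrite -!EFinM => -[bE]; congr EFin.
  rewrite -bE; field; rewrite G0//=.
  apply/eqP => b0; move: bE; rewrite b0 mulr0 => /esym/eqP.
  by rewrite mulf_eq0 (negbTE (G0 s s0)) (negbTE (G0 h h0)).
by rewrite gt0_muley ?lte_fin ?Gamma_gt0.
Qed.

End gamma_semigroup.

(** * Tails and potential density of the gamma semigroup *)

Definition gtail {R : realType} (s u : R) : \bar R :=
  (\int[lebesgue_measure]_t (gdens s t * (u <= t)%R%:R)%:E)%E.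

(* Equals [Skernel] on the positive half-line. *)
Definition gpot {R : realType} (t : R) : \bar R :=
  (\int[lebesgue_measure]_s (pos s * gdens s t)%:E)%E.

Section gamma_potential.
Context {R : realType}.
Local Open Scope ereal_scope.
Local Notation mu := (@lebesgue_measure R).
Implicit Types s h t u : R.

Lemma measurable_ler (u : R) :
  measurable_fun setT (fun t : R => (u <= t)%R%:R : R).
Proof.
rewrite (_ : (fun _ => _) = \1_(`[u, +oo[%classic : set R)).
  exact: measurable_indic.
by apply/funext => t; rewrite indicE mem_setE in_itv/= andbT.
Qed.

Lemma gcdf_ge0 s u : 0 <= gcdf s u.
Proof.
by apply: convol_ge0 => t; [exact: gdens_ge0|exact: epos_ge0].
Qed.

Lemma measurable_gcdf s : measurable_fun setT (gcdf s).
Proof.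
apply: measurable_convol; [exact: measurable_gdens|exact: measurable_epos|
  exact: gdens_ge0|exact: epos_ge0].
Qed.

Lemma measurable_pos_shift (u : R) : measurable_fun setT (fun y : R => pos (u - y)%R).
Proof.
apply: (measurableT_comp measurable_pos); exact: measurable_funB.
Qed.

Lemma measurable_gcdf_shape u : measurable_fun setT (fun s => gcdf s u).
Proof.
apply: (measurable_fun_fubini_tonelli_F (m2 := mu)
  (fun z : R * R => (gdens z.1 z.2)%:E * (pos (u - z.2)%R)%:E)).
- apply: emeasurable_funM; apply/measurable_EFinP; first exact: measurable_gdens2.
  exact: (measurableT_comp (measurable_pos_shift u)).
- by move=> z; rewrite mule_ge0 ?gdens_ge0 ?epos_ge0.
Qed.

Lemma gcdf_le1 s u : (0 < s)%R -> gcdf s u <= 1.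
Proof.
move=> s0; rewrite -(integral_gdens s0) -(convol_cst1 _ u).
apply: le_convol.
- exact: measurable_gdens.
- exact: measurable_epos.
- exact: measurable_cst.
- exact: gdens_ge0.
- exact: epos_ge0.
- by move=> t; rewrite lee_fin pos_le1.
Qed.

(* Chernoff bound: [1_(y < u) <= exp (u - y)]. *)
Lemma gcdf_le_exp s u : (0 < s)%R -> gcdf s u <= (expR (u - s * ln 2))%:E.
Proof.
move=> s0; rewrite expRD EFinM -integral_gdens_exp//.
have mge : measurable_fun setT (fun t => (gdens s t * expR (- t))%:E).
  apply/measurable_EFinP; apply: measurable_funM.
    by apply/measurable_EFinP; exact: measurable_gdens.
  by apply: measurableT_comp => //; exact: measurable_funN.
have ge0 t : 0 <= (gdens s t * expR (- t))%:E.
  by rewrite EFinM mule_ge0 ?gdens_ge0// lee_fin expR_ge0.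
rewrite -ge0_integralZl//.
apply: ge0_le_integral => //.
- by move=> y _; rewrite mule_ge0 ?gdens_ge0 ?epos_ge0.
- exact: (measurable_convol_integrand u (measurable_gdens s) measurable_epos).
- exact: measurable_funeM.
- move=> y _; rewrite [leRHS]/= [in leRHS]EFinM muleCA.
  apply: lee_wpmul2l; first exact: gdens_ge0.
  rewrite -EFinM lee_fin -expRD posE subr_gt0; case: ltP => yu /=.
    by rewrite -expR0 ler_expR subr_ge0 ltW.
  exact: expR_ge0.
Qed.

Lemma gcdfD s h u : (0 < s)%R -> (0 < h)%R ->
  gcdf (s + h) u = convol (fun t => (gdens s t)%:E) (gcdf h) u.
Proof.
move=> s0 h0; rewrite -convolA.
- by congr convol; apply/funext => r; rewrite convol_gdens.
- exact: measurable_gdens.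
- exact: measurable_gdens.
- exact: measurable_epos.
- exact: gdens_ge0.
- exact: gdens_ge0.
- exact: epos_ge0.
Qed.

Lemma gtail_ge0 s u : 0 <= gtail s u.
Proof.
by apply: integral_ge0 => t _; rewrite EFinM mule_ge0 ?gdens_ge0// lee_fin.
Qed.

Lemma measurable_gtail s : measurable_fun setT (gtail s).
Proof.
apply: (measurable_fun_fubini_tonelli_F (m2 := mu)
  (fun z : R * R => (gdens s z.2 * (z.1 <= z.2)%R%:R)%:E)).
- apply/measurable_EFinP; apply: measurable_funM.
    apply: (measurableT_comp (f := gdens s)) => //.
    by apply/measurable_EFinP; exact: measurable_gdens.
  rewrite (_ : (fun _ => _) = (fun z => 1 - pos (z.1 - z.2))%R).
    apply: measurable_funB => //; apply: (measurableT_comp measurable_pos).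
    exact: measurable_funB.
  by apply/funext => z; rewrite posE subr_gt0; case: ltP; rewrite ?subrr ?subr0.
- by move=> z; rewrite EFinM mule_ge0 ?gdens_ge0// lee_fin.
Qed.

(** The weak inequality in [gtail] complements the strict one in [gcdf], so the integrands add up to
    the density at every point. *)
Lemma gcdf_gtail s u : (0 < s)%R -> gcdf s u + gtail s u = 1.
Proof.
move=> s0; rewrite -(integral_gdens s0) /gcdf /convol -ge0_integralD//.
- apply: eq_integral => t _; rewrite -EFinM -EFinD; congr EFin.
  by rewrite posE subr_gt0; case: ltP => _; rewrite /= ?(mulr1, mulr0, addr0, add0r).
- by move=> t _; rewrite mule_ge0 ?gdens_ge0 ?epos_ge0.
- exact: (measurable_convol_integrand u (measurable_gdens s) measurable_epos).
- by move=> t _; rewrite EFinM mule_ge0 ?gdens_ge0// lee_fin.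
- apply/measurable_EFinP; apply: measurable_funM; last exact: measurable_ler.
  by apply/measurable_EFinP; exact: measurable_gdens.
Qed.

Lemma gcdf_le0 s u : (u <= 0)%R -> gcdf s u = 0.
Proof.
move=> u0; apply: integral0_eq => t _; rewrite -EFinM /gdens !posE subr_gt0.
case: ltP => t0; last by rewrite !mul0r.
by rewrite ltNge (le_trans u0 (ltW t0)) mulr0.
Qed.

(** For [u <= 0] the tail equals 1 while [gcdf] is 0, hence the factor [pos u] on the tail alone. *)
Lemma pos_gcdf_gtail s u : (0 < s)%R ->
  (pos u)%:E = gcdf s u + (pos u)%:E * gtail s u.
Proof.
move=> s0; rewrite posE; case: ltP => u0 /=; first by rewrite mul1e gcdf_gtail.
by rewrite mul0e adde0 gcdf_le0.
Qed.

Lemma measurable_gpot_integrand :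
  measurable_fun setT (fun z : R * R => (pos z.2 * gdens z.2 z.1)%:E).
Proof.
apply/measurable_EFinP; apply: measurable_funM.
  exact: (measurableT_comp measurable_pos).
apply: (measurableT_comp (f := fun z : R * R => gdens z.1 z.2)
  (g := fun z : R * R => (z.2, z.1))); first exact: measurable_gdens2.
exact: measurable_fun_pair.
Qed.

Lemma gpot_integrand_ge0 s t : 0 <= (pos s * gdens s t)%:E.
Proof. by rewrite EFinM mule_ge0 ?gdens_ge0 ?epos_ge0. Qed.

Lemma gpot_ge0 t : 0 <= gpot t.
Proof. by apply: integral_ge0 => s _; exact: gpot_integrand_ge0. Qed.

Lemma measurable_gpot : measurable_fun setT (@gpot R).
Proof.
apply: (measurable_fun_fubini_tonelli_F (m2 := mu) _ measurable_gpot_integrand).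
by move=> z; exact: gpot_integrand_ge0.
Qed.

Lemma convol_gpot (f : R -> \bar R) u :
  measurable_fun setT f -> (forall t, 0 <= f t) ->
  convol gpot f u =
  \int[mu]_s ((pos s)%:E * convol (fun t => (gdens s t)%:E) f u).
Proof.
move=> mf f0.
have mfu : measurable_fun setT (fun y : R => f (u - y)%R).
  by apply: measurableT_comp => //; exact: measurable_funB.
transitivity (\int[mu]_y \int[mu]_s ((pos s * gdens s y)%:E * f (u - y)%R)).
  apply: eq_integral => y _; rewrite ge0_integralZr//.
  - exact: (measurableT_comp measurable_gpot_integrand (measurable_pair1 y)).
  - by move=> s _; exact: gpot_integrand_ge0.
rewrite lebesgue_tonelli; last 2 first.
- apply: emeasurable_funM; first exact: measurable_gpot_integrand.
  exact: (measurableT_comp mfu).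
- by move=> y s; rewrite mule_ge0// gpot_integrand_ge0.
apply: eq_integral => s _; rewrite /convol -ge0_integralZl//.
- by apply: eq_integral => y _; rewrite EFinM muleA.
- exact: (measurable_convol_integrand u (measurable_gdens s) mf).
- by move=> y _; rewrite mule_ge0// gdens_ge0.
- exact: epos_ge0.
Qed.

(** The Chernoff bound decays in [s] like an exponential density of rate [ln 2], hence is integrable
    over [s > 0]. *)
Lemma convol_gpot_pos_lty u : convol gpot (fun t => (pos t)%:E) u < +oo.
Proof.
rewrite convol_gpot; [|exact: measurable_epos|exact: epos_ge0].
have ln2 : (0 < ln 2 :> R)%R by rewrite ln_gt0// ltr1n.
have mE : measurable_fun setT (fun t : R => (exponential_pdf (ln 2) t)%:E).
  by apply/measurable_EFinP; exact: measurable_exponential_pdf.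
have E0 (t : R) : 0 <= (exponential_pdf (ln 2) t)%:E.
  by rewrite lee_fin exponential_pdf_ge0// ltW.
apply: (@le_lt_trans _ _
    (\int[mu]_s ((expR u / ln 2)%:E * (exponential_pdf (ln 2) s)%:E))).
  apply: ge0_le_integral => //.
  - by move=> s _; rewrite mule_ge0 ?epos_ge0 ?gcdf_ge0.
  - apply: emeasurable_funM; first exact: measurable_epos.
    exact: measurable_gcdf_shape.
  - exact: measurable_funeM.
  - move=> s _; rewrite {1}posE; case: ltP => s0 /=; last first.
      by rewrite mul0e mule_ge0// lee_fin divr_ge0 ?expR_ge0// ltW.
    rewrite mul1e (le_trans (gcdf_le_exp u s0))// -EFinM lee_fin.
    rewrite exponential_pdfE ?(ltW s0)// mulrA divfK ?gt_eqF// -expRD.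
    by rewrite ler_expR mulNr mulrC.
rewrite ge0_integralZl//; last by rewrite lee_fin divr_ge0 ?expR_ge0// ltW.
by rewrite integral_exponential_pdf// mule1 ltry.
Qed.

(* Telescoping: [convol (gdens s) (pos - gcdf h) = gcdf s - gcdf (s + h)], which
   is integrated over [s > 0]. *)
Lemma convol_gpot_gtail h u : (0 < h)%R ->
  convol gpot (fun w => (pos w)%:E * gtail h w) u =
  \int[mu]_s ((pos s * (s <= h)%R%:R)%:E * gcdf s u).
Proof.
move=> h0.
have mT : measurable_fun setT (fun w => (pos w)%:E * gtail h w).
  by apply: emeasurable_funM; [exact: measurable_epos|exact: measurable_gtail].
have T0 w : 0 <= (pos w)%:E * gtail h w by rewrite mule_ge0 ?epos_ge0 ?gtail_ge0.
have mle : measurable_fun setT (fun s : R => (s <= h)%R%:R : R).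
  rewrite (_ : (fun _ => _) = \1_(`]-oo, h]%classic : set R)).
    exact: measurable_indic.
  by apply/funext => t; rewrite indicE mem_setE in_itv.
have mG1 : measurable_fun setT (fun s => (pos s * (s <= h)%R%:R)%:E * gcdf s u).
  apply: emeasurable_funM; last exact: measurable_gcdf_shape.
  by apply/measurable_EFinP; apply: measurable_funM => //; exact: measurable_pos.
have G10 s : 0 <= (pos s * (s <= h)%R%:R)%:E * gcdf s u.
  by rewrite mule_ge0 ?gcdf_ge0// lee_fin mulr_ge0 ?pos_ge0.
have mG2 : measurable_fun setT (fun s : R => (pos (s - h)%R)%:E * gcdf s u).
  apply: emeasurable_funM; last exact: measurable_gcdf_shape.
  apply/measurable_EFinP; apply: (measurableT_comp measurable_pos).
  exact: measurable_funB.
have G20 s : 0 <= (pos (s - h)%R)%:E * gcdf s u by rewrite mule_ge0 ?epos_ge0 ?gcdf_ge0.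
set I1 := RHS; pose I2 := \int[mu]_s ((pos (s - h)%R)%:E * gcdf s u).
have total : convol gpot (fun t => (pos t)%:E) u = I1 + I2.
  rewrite convol_gpot; [|exact: measurable_epos|exact: epos_ge0].
  rewrite /I1 /I2 -ge0_integralD//; apply: eq_integral => s _.
  rewrite -ge0_muleDl; [|by rewrite lee_fin mulr_ge0 ?pos_ge0|exact: epos_ge0].
  congr (_ * _); rewrite -EFinD; congr EFin; rewrite !posE subr_gt0.
  case: (ltP h s) => hs /=; last by rewrite mulr1 addr0.
  by rewrite (lt_trans h0 hs) mulr0 add0r.
have part : convol gpot (gcdf h) u = I2.
  rewrite convol_gpot; [|exact: measurable_gcdf|exact: gcdf_ge0].
  rewrite /I2 (@ge0_integral_affine R 1 h _ _ mG2) ?oner_neq0//.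
  rewrite normr1 mul1e.
  apply: eq_integral => s _; rewrite mul1r addrK !posE.
  by case: ltP => s0 /=; rewrite ?mul0e// gcdfD.
(* Cancelling [I2] in [\bar R] needs its finiteness, obtained from the larger quantity [I1 + I2]. *)
have I2_fin : I2 \is a fin_num.
  rewrite ge0_fin_numE; last by apply: integral_ge0 => s _.
  apply: le_lt_trans (convol_gpot_pos_lty u).
  by rewrite total; apply: leeDr; apply: integral_ge0 => s _.
have split : I1 + I2 = convol gpot (fun w => (pos w)%:E * gtail h w) u + I2.
  rewrite -total -part addeC.
  rewrite -(convolDr u measurable_gpot (measurable_gcdf h) mT gpot_ge0
    (gcdf_ge0 h) T0).
  by congr convol; apply/funext => w; exact: (pos_gcdf_gtail w h0).
by rewrite -[LHS](addeK _ I2_fin) -split addeK.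
Qed.

End gamma_potential.

(** * Sonine identity *)

(** The upper incomplete gamma function, with [s = 0] allowed. At [s = 0] and [w <= 0] it is
    infinite, which explains both the extended values and the factor [pos w] that accompanies it
    below. *)
Definition incgamma {R : realType} (s w : R) : \bar R :=
  (\int[lebesgue_measure]_t (gker s t * (w <= t)%R%:R)%:E)%E.

Section sonine.
Context {R : realType}.
Local Open Scope ereal_scope.
Local Notation mu := (@lebesgue_measure R).
Implicit Types s h t u w : R.

Lemma incgamma_integrand_ge0 s w t : 0 <= (gker s t * (w <= t)%R%:R)%:E.
Proof. by rewrite lee_fin mulr_ge0// gker_ge0. Qed.

Lemma measurable_incgamma_integrand s w :
  measurable_fun setT (fun t => (gker s t * (w <= t)%R%:R)%:E).
Proof.
apply/measurable_EFinP; apply: measurable_funM; last exact: measurable_ler.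
exact: measurable_gker.
Qed.

Lemma incgamma_ge0 s w : 0 <= incgamma s w.
Proof. by apply: integral_ge0 => t _; exact: incgamma_integrand_ge0. Qed.

Lemma measurable_incgamma s : measurable_fun setT (incgamma s).
Proof.
apply: (measurable_fun_fubini_tonelli_F (m2 := mu)
  (fun z : R * R => (gker s z.2 * (z.1 <= z.2)%R%:R)%:E)).
- apply/measurable_EFinP; apply: measurable_funM.
    by apply: (measurableT_comp (f := gker s)) => //; exact: measurable_gker.
  rewrite (_ : (fun _ => _) = (fun z => 1 - pos (z.1 - z.2))%R).
    apply: measurable_funB => //; apply: (measurableT_comp measurable_pos).
    exact: measurable_funB.
  by apply/funext => z; rewrite posE subr_gt0; case: ltP; rewrite ?subrr ?subr0.
- by move=> z; exact: incgamma_integrand_ge0.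
Qed.

Lemma incgamma_gtail s w : (0 < s)%R ->
  incgamma s w = (Gamma s)%:E * gtail s w.
Proof.
move=> s0; have G0 := Gamma_gt0 s0; rewrite /gtail -ge0_integralZl//.
- apply: eq_integral => t _; rewrite -EFinM gdensE//; congr EFin.
  by field; rewrite gt_eqF.
- apply/measurable_EFinP; apply: measurable_funM; last exact: measurable_ler.
  by apply/measurable_EFinP; exact: measurable_gdens.
- by move=> t _; rewrite EFinM mule_ge0 ?gdens_ge0// lee_fin.
- by rewrite lee_fin ltW.
Qed.

Lemma gker_shift s h t : gker (s + h) t = (expR (h * ln t) * gker s t)%R.
Proof. by rewrite /gker mulrCA -expRD; congr (_ * expR _)%R; ring. Qed.

(** On [t >= w] one has [t^h >= min(w,1)^h]. The cap at 1 makes this factor monotone in [h], as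
    monotone convergence will require. *)
Lemma incgamma_ge h w : (0 <= h)%R -> (0 < w)%R ->
  (expR (h * ln (Num.min w 1%R)))%:E * incgamma 0 w <= incgamma h w.
Proof.
move=> h0 w0; rewrite /incgamma -ge0_integralZl//; last 2 first.
- exact: measurable_incgamma_integrand.
- by move=> t _; exact: incgamma_integrand_ge0.
apply: ge0_le_integral => //.
- by move=> t _; rewrite mule_ge0 ?incgamma_integrand_ge0// lee_fin expR_ge0.
- by apply: measurable_funeM; exact: measurable_incgamma_integrand.
- exact: measurable_incgamma_integrand.
- move=> t _; rewrite -EFinM lee_fin; case: (leP w t) => wt /=; last by rewrite !mulr0.
  rewrite !mulr1 -[leRHS]/(gker h t) -(add0r h) gker_shift add0r.
  apply: ler_wpM2r; first exact: gker_ge0.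
  rewrite ler_expR ler_wpM2l// ler_ln ?posrE ?lt_min ?w0 ?ltr01//.
    by rewrite ge_min wt.
  exact: lt_le_trans wt.
Qed.

(** This is [t^h <= 1 + h t^2]. For [t > 1] put [x = h * ln t]: then [1 - x <= expR (- x)] gives
    [expR x <= 1 + x * expR x], where [x <= h * t] and [expR x <= t]. *)
Lemma gker_le h t : (0 < h)%R -> (h <= 1)%R ->
  (gker h t <= gker 0 t + h * gker 2 t)%R.
Proof.
move=> h0 h1; have [t0|t0] := ltP 0%R t; last first.
  by rewrite /gker posE ltNge t0 !mul0r mulr0 addr0.
have -> : gker 2 t = (t ^+ 2 * gker 0 t)%R.
  rewrite -[in LHS](add0r 2%R) gker_shift; congr (_ * _)%R.
  by rewrite mulr_natl -lnXn// lnK// posrE exprn_gt0.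
rewrite -[in leLHS](add0r h) gker_shift mulrA -[X in (X + _)%R]mul1r -mulrDl.
apply: ler_wpM2r; first exact: gker_ge0.
have [t1|t1] := leP t 1%R.
  rewrite (@le_trans _ _ 1%R)//.
    by rewrite expR_le1 mulr_ge0_le0 ?ln_le0// ltW.
  by rewrite lerDl mulr_ge0 ?exprn_ge0// ltW.
have lnt0 : (0 <= ln t)%R by rewrite ln_ge0// ltW.
have lnt : (ln t <= t)%R by rewrite ltW// ln_sublinear.
set x := (h * ln t)%R.
have x0 : (0 <= x)%R by rewrite mulr_ge0// ltW.
have ex : (expR x <= t)%R.
  by rewrite -[leRHS]lnK ?posrE// ler_expR /x ler_piMl.
have xt : (x <= h * t)%R by rewrite ler_wpM2l// ltW.
have exx : (expR x <= 1 + x * expR x)%R.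
  have := expR_ge1Dx (- x); rewrite -(ler_pM2r (expR_gt0 x)) -expRD addNr expR0.
  by lra.
apply: (le_trans exx); rewrite lerD2l expr2 mulrA.
by apply: ler_pM => //; exact: expR_ge0.
Qed.

(** The cut-off at [w] is dropped in the correction term of [gker_le], so the error is uniform in
    [w]. *)
Lemma incgamma_le h w : (0 < h)%R -> (h <= 1)%R ->
  incgamma h w <= incgamma 0 w + (h * Gamma 2)%:E.
Proof.
move=> h0 h1; have m2 : measurable_fun setT (fun t : R => (gker 2 t)%:E).
  by apply/measurable_EFinP; exact: measurable_gker.
have g20 (t : R) : 0 <= (gker 2 t)%:E by rewrite lee_fin gker_ge0.
rewrite EFinM -integral_gker// -ge0_integralZl//; last by rewrite lee_fin ltW.
rewrite -ge0_integralD//; last 4 first.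
- by move=> t _; exact: incgamma_integrand_ge0.
- exact: measurable_incgamma_integrand.
- by move=> t _; rewrite mule_ge0// lee_fin ltW.
- exact: measurable_funeM.
apply: ge0_le_integral => //.
- by move=> t _; exact: incgamma_integrand_ge0.
- exact: measurable_incgamma_integrand.
- apply: emeasurable_funD; first exact: measurable_incgamma_integrand.
  exact: measurable_funeM.
- move=> t _; rewrite -EFinM -EFinD lee_fin; case: (leP w t) => wt /=.
    by rewrite !mulr1 gker_le.
  by rewrite !mulr0 add0r mulr_ge0 ?gker_ge0// ltW.
Qed.

(** The factor [2 * s] bounds [(Gamma s)^-1], because [Gamma s >= s^-1 - 1 >= (2 * s)^-1]. The
    factor [1 + u^-1] bounds [t^(s-1)] on [t >= u]: by 1 if [t >= 1], by [t^-1] otherwise. *)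
Lemma gtail_le s u : (0 < s)%R -> (s <= 2^-1)%R -> (0 < u)%R ->
  gtail s u <= (s * (2 * (1 + u^-1)))%:E.
Proof.
move=> s0 s12 u0; have G0 := Gamma_gt0 s0.
have ui : (0 < u^-1)%R by rewrite invr_gt0.
have Gle : ((Gamma s)^-1 <= 2 * s)%R.
  rewrite -[leRHS]invrK lef_pV2 ?posrE ?invr_gt0 ?mulr_gt0//.
  rewrite (le_trans _ (Gamma_ge_near0 s0))// invfM.
  suff : (2 <= s^-1)%R by lra.
  by rewrite -[leLHS]invrK lef_pV2 ?posrE ?invr_gt0.
have mE : measurable_fun setT (fun t : R => (exponential_pdf 1 t)%:E).
  by apply/measurable_EFinP; exact: measurable_exponential_pdf.
have E0 (t : R) : 0 <= (exponential_pdf 1 t)%:E.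
  by rewrite lee_fin exponential_pdf_ge0.
have c0 : (0 <= (s * (2 * (1 + u^-1))))%R.
  by rewrite !mulr_ge0 ?addr_ge0 ?ltW.
rewrite -[leRHS]mule1 -(@integral_exponential_pdf R 1)// -ge0_integralZl//.
apply: ge0_le_integral => //.
- by move=> t _; rewrite EFinM mule_ge0 ?gdens_ge0// lee_fin.
- apply/measurable_EFinP; apply: measurable_funM; last exact: measurable_ler.
  by apply/measurable_EFinP; exact: measurable_gdens.
- exact: measurable_funeM.
- move=> t _; rewrite -EFinM lee_fin; case: (leP u t) => ut /=; last first.
    by rewrite mulr0 mulr_ge0// exponential_pdf_ge0.
  have t0 : (0 < t)%R by exact: lt_le_trans ut.
  rewrite mulr1 gdensE// exponential_pdfE ?(ltW t0)// mulN1r mul1r.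
  rewrite gker_powR posE t0 mul1r.
  have -> : (s * (2 * (1 + u^-1)) * expR (- t) =
    (1 + u^-1) * expR (- t) * (2 * s))%R by ring.
  apply: ler_pM; rewrite ?mulr_ge0 ?powR_ge0 ?expR_ge0 ?invr_ge0// ?(ltW G0)//.
  apply: ler_wpM2r; first exact: expR_ge0.
  rewrite /powR gt_eqF//; have [t1|t1] := leP 1%R t.
    have : (expR ((s - 1) * ln t) <= 1)%R.
      by rewrite expR_le1 mulr_le0_ge0 ?ln_ge0//; lra.
    by lra.
  have lnt : (ln t <= 0)%R by rewrite ln_le0// ltW.
  have : (expR ((s - 1) * ln t) <= t^-1)%R.
    by rewrite -[leRHS]lnK ?posrE ?invr_gt0// ler_expR lnV ?posrE//; nra.
  have : (t^-1 <= u^-1)%R by rewrite lef_pV2.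
  by lra.
Qed.

Let loc h s : R := (pos s * (s <= h)%R%:R)%R.

Let locE h : loc h = \1_(`]0%R, h]%classic : set R).
Proof.
apply/funext => s; rewrite /loc posE indicE mem_setE in_itv/=.
by rewrite -natrM mulnb.
Qed.

Let measurable_loc h : measurable_fun setT (fun s => (loc h s)%:E).
Proof. by rewrite locE; apply/measurable_EFinP; exact: measurable_indic. Qed.

Let integral_loc h : (0 < h)%R -> \int[mu]_s (loc h s)%:E = h%:E.
Proof.
move=> h0; rewrite locE integral_indic//= setIT lebesgue_measure_itv/=.
by rewrite lte_fin h0 sube0.
Qed.

Let loc_ge0 h s : 0 <= (loc h s)%:E.
Proof. by rewrite lee_fin mulr_ge0 ?pos_ge0. Qed.

Let measurable_pos_incgamma h :
  measurable_fun setT (fun w => (pos w)%:E * incgamma h w).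
Proof.
by apply: emeasurable_funM; [exact: measurable_epos|exact: measurable_incgamma].
Qed.

Let pos_incgamma_ge0 h w : 0 <= (pos w)%:E * incgamma h w.
Proof. by rewrite mule_ge0 ?epos_ge0 ?incgamma_ge0. Qed.

Let convol_gpot_incgamma h u : (0 < h)%R ->
  convol gpot (fun w => (pos w)%:E * incgamma h w) u =
  (Gamma h)%:E * \int[mu]_s ((loc h s)%:E * gcdf s u).
Proof.
move=> h0; have mT : measurable_fun setT (fun w => (pos w)%:E * gtail h w).
  by apply: emeasurable_funM; [exact: measurable_epos|exact: measurable_gtail].
have T0 w : 0 <= (pos w)%:E * gtail h w by rewrite mule_ge0 ?epos_ge0 ?gtail_ge0.
have G0 : (0 <= Gamma h)%R by rewrite ltW// Gamma_gt0.
rewrite -(convol_gpot_gtail u h0) -(convolZr u measurable_gpot mT gpot_ge0 T0 G0).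
congr (convol _ _ _); apply/funext => w.
by rewrite (incgamma_gtail w h0) muleCA.
Qed.

Let measurable_loc_gcdf h u :
  measurable_fun setT (fun s => (loc h s)%:E * gcdf s u).
Proof. by apply: emeasurable_funM => //; exact: measurable_gcdf_shape. Qed.

Let integral_loc_gcdf_le h u : (0 < h)%R ->
  \int[mu]_s ((loc h s)%:E * gcdf s u) <= h%:E.
Proof.
move=> h0; rewrite -integral_loc//; apply: ge0_le_integral => //.
- by move=> s _; rewrite mule_ge0// gcdf_ge0.
- exact: measurable_loc_gcdf.
- exact: measurable_loc.
- move=> s _; rewrite /loc posE; case: ltP => s0 /=; last by rewrite mul0r mul0e.
  by rewrite -[leRHS]mule1 lee_wpmul2l// ?gcdf_le1// lee_fin mulr_ge0.
Qed.

(** On the window [s <= h], [gcdf] is 1 minus a tail of size at most [h * c]. If [1 - h * c] is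
    nonpositive, nonnegativity of the integral suffices. *)
Let integral_loc_gcdf_ge h u : (0 < h)%R -> (h <= 2^-1)%R -> (0 < u)%R ->
  (h * (1 - h * (2 * (1 + u^-1))))%:E <=
  \int[mu]_s ((loc h s)%:E * gcdf s u).
Proof.
move=> h0 h12 u0; set c := (2 * (1 + u^-1))%R.
have c0 : (0 <= c)%R by rewrite mulr_ge0// addr_ge0// invr_ge0 ltW.
have [hc|hc] := leP (1 - h * c)%R 0%R.
  apply: (@le_trans _ _ 0).
    by rewrite lee_fin mulr_ge0_le0// ltW.
  by apply: integral_ge0 => s _; rewrite mule_ge0// gcdf_ge0.
rewrite EFinM -integral_loc// -ge0_integralZr//; last 2 first.
- exact: measurable_loc.
- by rewrite lee_fin ltW.
apply: ge0_le_integral => //.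
- by move=> s _; rewrite mule_ge0// lee_fin ltW.
- by apply: emeasurable_funM => //; exact: measurable_loc.
- exact: measurable_loc_gcdf.
- move=> s _; rewrite /loc posE; case: ltP => s0 /=; last by rewrite !mul0r !mul0e.
  case: (leP s h) => sh /=; last by rewrite !mulr0 !mul0e.
  rewrite mulr1 !mul1e.
  have : gtail s u <= (h * c)%:E.
    rewrite (le_trans (gtail_le s0 _ u0))// ?(le_trans sh)// lee_fin.
    exact: ler_wpM2r.
  have := gcdf_gtail u s0; have := gcdf_ge0 s u; have := gtail_ge0 s u.
  case: (gcdf s u) => [G||//]; last by move=> *; exact: leey.
  case: (gtail s u) => [T|//|//].
  rewrite -EFinD !lee_fin => _ _ [GT]; lra.
Qed.

Let sonine_ge1 u : (0 < u)%R ->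
  1 <= convol gpot (fun w => (pos w)%:E * incgamma 0 w) u.
Proof.
move=> u0; set Q := convol _ _ _.
have Q0 : 0 <= Q by apply: convol_ge0 => // t; exact: gpot_ge0.
set M := convol gpot (fun w : R => (pos w)%:E) u.
have M0 : 0 <= M.
  by apply: convol_ge0 => t; [exact: gpot_ge0|exact: epos_ge0].
have Mfin : M \is a fin_num by rewrite ge0_fin_numE// convol_gpot_pos_lty.
pose c := (2 * (1 + u^-1))%R.
have c0 : (0 <= c)%R by rewrite mulr_ge0// addr_ge0// invr_ge0 ltW.
have G2 : (0 < Gamma 2 :> R)%R by exact: Gamma_gt0.
have key h : (0 < h)%R -> (h <= 2^-1)%R ->
    ((1 - h) * (1 - h * c))%:E <= Q + (h * Gamma 2)%:E * M.
  move=> h0 h12; have h1 : (h <= 1)%R by lra.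
  have hG0 : (0 <= h * Gamma 2)%R by rewrite mulr_ge0// ltW.
  have [hc|hc] := leP (1 - h * c)%R 0%R.
    apply: (@le_trans _ _ 0); last by rewrite adde_ge0// mule_ge0.
    by rewrite lee_fin mulr_ge0_le0// subr_ge0.
  apply: (@le_trans _ _ (convol gpot (fun w => (pos w)%:E * incgamma h w) u)).
    rewrite (convol_gpot_incgamma u h0).
    apply: (@le_trans _ _ ((Gamma h)%:E * (h * (1 - h * c))%:E)).
      rewrite -EFinM lee_fin [leRHS]mulrA; apply: ler_wpM2r; first exact: ltW.
      have : ((h^-1 - 1) * h <= Gamma h * h)%R.
        by rewrite (ler_pM2r h0); exact: Gamma_ge_near0.
      by rewrite mulrBl mulVf ?gt_eqF// mul1r.
    apply: lee_wpmul2l; first by rewrite lee_fin ltW// Gamma_gt0.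
    exact: integral_loc_gcdf_ge.
  rewrite /Q /M -(convolZr u measurable_gpot measurable_epos gpot_ge0 epos_ge0 hG0).
  have mZ : measurable_fun setT (fun w : R => (h * Gamma 2)%:E * (pos w)%:E).
    by apply: measurable_funeM; exact: measurable_epos.
  have Z0 w : 0 <= (h * Gamma 2)%:E * (pos w)%:E by rewrite mule_ge0 ?epos_ge0.
  rewrite -(convolDr u measurable_gpot (measurable_pos_incgamma 0) mZ gpot_ge0
    (pos_incgamma_ge0 0) Z0).
  apply: (le_convol u measurable_gpot (measurable_pos_incgamma h) _ gpot_ge0
    (pos_incgamma_ge0 h)).
  - by apply: emeasurable_funD => //; exact: measurable_pos_incgamma.
  - move=> w; rewrite /= [X in _ <= _ + X]muleC -ge0_muleDr//.
    + by apply: lee_wpmul2l; [exact: epos_ge0|exact: incgamma_le].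
    + exact: incgamma_ge0.
case: Q Q0 key => [q|_ _|//]; last exact: leey.
rewrite !lee_fin => q0 key.
(* [D] collects the terms linear in [h]; the quadratic term [h * h * c] is nonnegative and is
   dropped, leaving [1 - h * D <= q]. *)
pose D := (1 + c + Gamma 2 * fine M)%R.
have D0 : (0 < D)%R.
  have : (0 <= Gamma 2 * fine M)%R by apply: mulr_ge0; [exact: ltW|exact: fine_ge0].
  by rewrite /D; lra.
have {}key h : (0 < h)%R -> (h <= 2^-1)%R -> (1 - h * D <= q)%R.
  move=> h0 h12; have := key h h0 h12.
  rewrite -(fineK Mfin) -EFinM -EFinD lee_fin /D.
  have : (0 <= h * h * c)%R by apply: mulr_ge0 => //; apply: mulr_ge0; exact: ltW.
  lra.
apply/ler_addgt0Pr => e e0.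
pose h := Num.min (2^-1)%R (e / D)%R.
have h0 : (0 < h)%R by rewrite lt_min invr_gt0 divr_gt0// ltr0n.
have h12 : (h <= 2^-1)%R by rewrite ge_min lexx.
have hD : (h * D <= e)%R by rewrite -ler_pdivlMr// ge_min lexx orbT.
have := key h h0 h12; lra.
Qed.

(** [min(w,1)^h] on [w > 0], the factor of [incgamma_ge]; it increases to [pos w] as [h] decreases
    to 0. *)
Let corr h w : \bar R := (pos w * expR (h * ln (Num.min w 1%R)))%:E.

Let measurable_corr h : measurable_fun setT (corr h).
Proof.
apply/measurable_EFinP; apply: measurable_funM; first exact: measurable_pos.
apply: measurableT_comp => //; apply: measurable_funM => //.
by apply: (measurableT_comp (@measurable_ln R)); exact: measurable_minr.
Qed.

Let corr_ge0 h w : 0 <= corr h w.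
Proof. by rewrite lee_fin mulr_ge0 ?pos_ge0 ?expR_ge0. Qed.

Let corr_le h k w : (h <= k)%R -> corr k w <= corr h w.
Proof.
move=> hk; rewrite lee_fin ler_wpM2l ?pos_ge0// ler_expR.
have : (ln (Num.min w 1%R) <= 0)%R by rewrite ln_le0// ge_min lexx orbT.
by nra.
Qed.

Let cvg_corr w : corr n.+1%:R^-1 w @[n --> \oo] --> (pos w)%:E.
Proof.
apply: cvg_EFin; first exact: nearW.
rewrite -[X in _ --> X]mulr1; apply: cvgM; first exact: cvg_cst.
rewrite -[X in _ --> X]expR0; apply: continuous_cvg; first exact: continuous_expR.
rewrite -[X in _ --> X](mul0r (ln (Num.min w 1%R))); apply: cvgM; last exact: cvg_cst.
exact: cvg_harmonic.
Qed.

Let sonine_approx h u : (0 < h)%R -> (h <= 1)%R ->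
  convol gpot (fun w => corr h w * incgamma 0 w) u <= (1 + h)%:E.
Proof.
move=> h0 h1.
apply: (@le_trans _ _ (convol gpot (fun w => (pos w)%:E * incgamma h w) u)).
  apply: le_convol.
  - exact: measurable_gpot.
  - apply: emeasurable_funM; last exact: measurable_incgamma.
    exact: measurable_corr.
  - exact: measurable_pos_incgamma.
  - exact: gpot_ge0.
  - by move=> w; rewrite mule_ge0 ?incgamma_ge0.
  - move=> w; rewrite /corr posE; case: ltP => w0 /=; last by rewrite mul0r !mul0e.
    by rewrite mul1r mul1e; apply: incgamma_ge => //; exact: ltW.
rewrite convol_gpot_incgamma//.
apply: (@le_trans _ _ ((Gamma h)%:E * h%:E)).
  apply: lee_wpmul2l; first by rewrite lee_fin ltW// Gamma_gt0.
  exact: integral_loc_gcdf_le.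
rewrite -EFinM lee_fin.
have : (Gamma h * h <= (h^-1 + 1) * h)%R by rewrite ler_pM2r// Gamma_le_near0.
by rewrite mulrDl mulVf ?gt_eqF// mul1r.
Qed.

(** Monotone convergence along [h = 1/(n+1)] in [sonine_approx]; the finiteness of the limit is part
    of the conclusion. *)
Let sonine_le1 u : convol gpot (fun w => (pos w)%:E * incgamma 0 w) u <= 1.
Proof.
pose g n y := gpot y * (corr n.+1%:R^-1 (u - y)%R * incgamma 0 (u - y)%R).
have mc n : measurable_fun setT (fun w => corr n.+1%:R^-1 w * incgamma 0 w).
  by apply: emeasurable_funM; [exact: measurable_corr|exact: measurable_incgamma].
have mg n : measurable_fun setT (g n).
  exact: (measurable_convol_integrand u measurable_gpot (mc n)).
have g0 n y : 0 <= g n y.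
  by rewrite !mule_ge0 ?gpot_ge0 ?corr_ge0 ?incgamma_ge0.
have gnd y : {homo g ^~ y : n m / (n <= m)%N >-> n <= m}.
  move=> n m nm; apply: lee_wpmul2l; first exact: gpot_ge0.
  apply: lee_wpmul2r; first exact: incgamma_ge0.
  by apply: corr_le; rewrite lef_pV2 ?posrE// ler_nat.
have := @cvg_monotone_convergence _ _ R mu setT measurableT g mg
  (fun n y _ => g0 n y) (fun y _ => gnd y).
rewrite (_ : \int[mu]_(x in setT) limn (g ^~ x) =
  convol gpot (fun w => (pos w)%:E * incgamma 0 w) u); last first.
  apply: eq_integral => y _; apply/cvg_lim => //.
  rewrite /g; under eq_fun do rewrite muleCA.
  (* For [u - y <= 0] the limit of [corr] is 0 and may multiply [+oo], where [cvgeM] does not apply;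
     there the sequence is constant. *)
  rewrite muleCA; have [uy|uy] := ltP 0%R (u - y)%R.
    apply: cvgeM; [|exact: cvg_corr|exact: cvg_cst].
    by rewrite posE uy /mule_def; case: (_ * _) => //; exact: oner_neq0.
  rewrite (_ : (fun _ => _) = cst ((pos (u - y))%:E *
    (gpot y * incgamma 0 (u - y)%R))); first exact: cvg_cst.
  by apply/funext => n; rewrite /corr posE ltNge uy mul0r.
move=> gcvg; rewrite -(cvg_lim _ gcvg)//.
have h1 : (1 + n.+1%:R^-1)%:E @[n --> \oo] --> (1 : \bar R).
  apply: cvg_EFin; first exact: nearW.
  rewrite -[X in _ --> X]addr0; apply: cvgD; first exact: cvg_cst.
  exact: cvg_harmonic.
rewrite -(cvg_lim _ h1)//; apply: lee_lim.
- by apply/cvg_ex; eexists; exact: gcvg.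
- by apply/cvg_ex; eexists; exact: h1.
- apply: nearW => n; apply: sonine_approx; first by rewrite invr_gt0.
  by rewrite invf_le1// ler1n.
Qed.

Lemma convol_gpot_incgamma0 u :
  convol gpot (fun w => (pos w)%:E * incgamma 0 w) u = (pos u)%:E.
Proof.
rewrite posE; case: ltP => u0 /=.
  by apply/eqP; rewrite eq_le sonine_le1 sonine_ge1.
apply: integral0_eq => y _; rewrite posE subr_gt0; case: ltP => yu /=; last first.
  by rewrite mul0e mule0.
rewrite (_ : gpot y = 0) ?mul0e//; apply: integral0_eq => s _.
by rewrite /gdens (posE y) ltNge (ltW (lt_le_trans yu u0)) mul0r mulr0.
Qed.

End sonine.

(** * Identification of the kernels and the scaled Sonine identity *)

Section kernels.
Context {R : realType}.
Local Open Scope ereal_scope.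
Local Notation mu := (@lebesgue_measure R).
Implicit Types s t u w x r alpha : R.

(** [E1] is the [fine] part of an integral, so finiteness comes first: [incgamma_ge] at [h = 1]
    bounds [min(x,1) * incgamma 0 x] by [Gamma 1]. *)
Lemma incgamma0_E1 x : (0 < x)%R -> incgamma 0 x = (E1 x)%:E.
Proof.
move=> x0; have m1 : (0 < Num.min x 1)%R by rewrite lt_min x0 ltr01.
have fin : incgamma 0 x \is a fin_num.
  rewrite ge0_fin_numE ?incgamma_ge0//.
  have : (Num.min x 1)%:E * incgamma 0 x < +oo.
    apply: (@le_lt_trans _ _ (Gamma 1)%:E); last exact: ltry.
    have := incgamma_ge ler01 x0; rewrite mul1r lnK//; move=> /le_trans; apply.
    rewrite -integral_gker//; apply: ge0_le_integral => //.
    - by move=> t _; exact: incgamma_integrand_ge0.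
    - exact: measurable_incgamma_integrand.
    - by apply/measurable_EFinP; exact: measurable_gker.
    - by move=> t _; rewrite lee_fin ler_piMr ?gker_ge0 ?lern1 ?leq_b1.
  case: (incgamma 0 x) (incgamma_ge0 0 x) => [q _ _||//]; first exact: ltry.
  by rewrite gt0_muley.
rewrite -(fineK fin); congr EFin; rewrite /E1 /Rintegral; congr fine.
rewrite [RHS]integral_mkcond; apply: eq_integral => t _.
rewrite patchE mem_setE in_itv/= andbT.
case: (leP x t) => xt /=; last by rewrite mulr0.
have t0 : (0 < t)%R by exact: lt_le_trans xt.
rewrite mulr1 gker_powR posE t0 mul1r sub0r powR_inv1 ?(ltW t0)//.
by rewrite mulrC.
Qed.

Lemma gpot_Skernel t : (0 < t)%R -> gpot t = (Skernel t)%:E.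
Proof.
move=> t0.
have E s : (0 < s)%R ->
    gdens s t = (expR (- t) * (t `^ (s - 1) / Gamma s))%R.
  by move=> s0; rewrite gdensE// gker_powR posE t0 mul1r mulrAC mulrC mulrA.
(* With this [T], [Gamma_lower_bound] bounds [t^(s-1) / Gamma s] by
   [C * (t / T)^s = C * expR (- s)], which is integrable in [s]. *)
pose T := (t * expR 1)%R.
have T0 : (0 < T)%R by rewrite mulr_gt0 ?expR_gt0.
have T10 : (0 < T + 1)%R by rewrite addr_gt0.
pose C := (t^-1 * (T + 1) * expR (T + 1))%R.
have C0 : (0 <= C)%R by rewrite !mulr_ge0 ?expR_ge0 ?invr_ge0 ?ltW.
have mE : measurable_fun setT (fun s : R => (exponential_pdf 1 s)%:E).
  by apply/measurable_EFinP; exact: measurable_exponential_pdf.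
have E0 s : 0 <= (exponential_pdf 1 s : R)%:E.
  by rewrite lee_fin exponential_pdf_ge0.
have mg : measurable_fun setT (fun s : R => (pos s * (t `^ (s - 1) / Gamma s))%:E).
  rewrite (_ : (fun _ => _) =
      (fun s => (expR t)%:E * (pos s * gdens s t)%:E)).
    apply: measurable_funeM.
    exact: (measurableT_comp measurable_gpot_integrand (measurable_pair1 t)).
  apply/funext => s; rewrite -EFinM posE; congr EFin.
  case: ltP => s0 /=; last by rewrite !mul0r mulr0.
  by rewrite !mul1r E// [RHS]mulrA -expRD subrr expR0 mul1r.
have g0 s : 0 <= (pos s * (t `^ (s - 1) / Gamma s))%:E.
  rewrite lee_fin posE; case: ltP => s0 /=; last by rewrite mul0r.
  by rewrite mul1r divr_ge0 ?powR_ge0// ltW// Gamma_gt0.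
rewrite /Skernel /Rintegral integral_mkpos.
have fin : \int[mu]_s (pos s * (t `^ (s - 1) / Gamma s))%:E \is a fin_num.
  rewrite ge0_fin_numE; last by apply: integral_ge0 => s _.
  apply: (@le_lt_trans _ _ (\int[mu]_s (C%:E * (exponential_pdf 1 s)%:E))).
    apply: ge0_le_integral => //; first exact: measurable_funeM.
    move=> s _; rewrite -EFinM lee_fin posE; case: ltP => s0 /=; last first.
      by rewrite mul0r mulr_ge0// exponential_pdf_ge0.
    rewrite mul1r exponential_pdfE ?(ltW s0)// mul1r mulN1r.
    rewrite ler_pdivrMr ?Gamma_gt0//.
    have Ts : (T `^ s = expR (s * (ln t + 1)))%R.
      by rewrite /powR gt_eqF// /T lnM ?posrE ?expR_gt0// expRK.
    have -> : (t `^ (s - 1) = C * expR (- s) *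
        (T `^ s / (T + 1) * expR (- (T + 1))))%R.
      transitivity (t^-1 * expR (- s) * expR (s * (ln t + 1)) *
        (expR (T + 1) * expR (- (T + 1))))%R; last first.
        by rewrite Ts /C; field; rewrite !gt_eqF.
      rewrite -expRD subrr expR0 mulr1 /powR gt_eqF//.
      rewrite -[in RHS](@lnK R t) ?posrE// -expRN -!expRD expRK.
      by congr expR; ring.
    apply: ler_wpM2l; first by rewrite mulr_ge0 ?expR_ge0.
    exact: Gamma_lower_bound.
  rewrite ge0_integralZl// integral_exponential_pdf// mule1; exact: ltry.
rewrite EFinM fineK// -ge0_integralZl//.
apply: eq_integral => s _; rewrite -EFinM posE; congr EFin.
case: ltP => s0 /=; last by rewrite !mul0r mulr0.
by rewrite !mul1r E.
Qed.

Lemma gpot_le0 t : (t <= 0)%R -> gpot t = 0.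
Proof.
move=> t0; apply: integral0_eq => s _.
by rewrite /gdens (posE t) ltNge t0 mul0r mulr0.
Qed.

(** Extension by zero, here and in [Spkernel], turns integrals over [[x, b]] into integrals over the
    line; the value at 0 matters only on a null set. *)
Definition Jkernel alpha t : R := pos t * (alpha^-1 * E1 (t / alpha)).

Definition Spkernel alpha t : R := pos t * Skernel (t / alpha).

Lemma JkernelE alpha t : (0 < alpha)%R ->
  (Jkernel alpha t)%:E =
  (alpha^-1)%:E * ((pos (t / alpha))%:E * incgamma 0 (t / alpha)).
Proof.
move=> a0; rewrite mulrC posM ?invr_gt0// -mulrC /Jkernel posE.
case: ltP => t0 /=; last by rewrite mul0r mul0e mule0.
by rewrite incgamma0_E1 ?divr_gt0// mul1r mul1e.
Qed.

Lemma SpkernelE alpha t : (0 < alpha)%R ->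
  (Spkernel alpha t)%:E = gpot (t / alpha).
Proof.
move=> a0; rewrite /Spkernel posE; case: ltP => t0 /=.
  by rewrite gpot_Skernel ?divr_gt0// mul1r.
by rewrite gpot_le0 ?mul0r// pmulr_lle0// invr_gt0.
Qed.

Lemma measurable_Jkernel alpha : (0 < alpha)%R ->
  measurable_fun setT (Jkernel alpha).
Proof.
move=> a0; apply/measurable_EFinP.
rewrite (_ : EFin \o _ = (fun t => (alpha^-1)%:E *
    ((pos (t / alpha))%:E * incgamma 0 (t / alpha)))); last first.
  by apply/funext => t; rewrite -JkernelE.
apply: measurable_funeM.
have md : measurable_fun setT (fun t : R => t / alpha)%R.
  exact: measurable_funM.
apply: emeasurable_funM; first exact: (measurableT_comp measurable_epos md).
exact: (measurableT_comp (measurable_incgamma 0) md).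
Qed.

Lemma measurable_Spkernel alpha : (0 < alpha)%R ->
  measurable_fun setT (Spkernel alpha).
Proof.
move=> a0; apply/measurable_EFinP.
rewrite (_ : EFin \o _ = (fun t => gpot (t / alpha))); last first.
  by apply/funext => t; rewrite -SpkernelE.
apply: (measurableT_comp measurable_gpot); exact: measurable_funM.
Qed.

Lemma Jkernel_ge0 alpha t : (0 < alpha)%R -> (0 <= Jkernel alpha t)%R.
Proof.
move=> a0; rewrite -lee_fin JkernelE//.
by rewrite !mule_ge0 ?epos_ge0 ?incgamma_ge0// lee_fin invr_ge0 ltW.
Qed.

Lemma Spkernel_ge0 alpha t : (0 < alpha)%R -> (0 <= Spkernel alpha t)%R.
Proof. by move=> a0; rewrite -lee_fin SpkernelE// gpot_ge0. Qed.

(** The reflection [t = r - alpha * y] produces a convolution at [(r - x) / alpha]; its Jacobian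
    [alpha] cancels the [alpha^-1] of [Jkernel]. *)
Lemma sonine alpha x r : (0 < alpha)%R ->
  \int[mu]_t (Jkernel alpha (t - x) * Spkernel alpha (r - t))%:E =
  (pos (r - x))%:E.
Proof.
move=> a0; have an0 : (- alpha != 0)%R by rewrite oppr_eq0 gt_eqF.
have mI : measurable_fun setT
    (fun t => (Jkernel alpha (t - x) * Spkernel alpha (r - t))%:E).
  apply/measurable_EFinP; apply: measurable_funM.
    apply: (measurableT_comp (measurable_Jkernel a0)); exact: measurable_funB.
  apply: (measurableT_comp (measurable_Spkernel a0)); exact: measurable_funB.
rewrite (@ge0_integral_affine R (- alpha) r _ an0 mI); last first.
  by move=> t; rewrite lee_fin mulr_ge0// ?Jkernel_ge0// Spkernel_ge0.
rewrite normrN gtr0_norm//.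
have mG : measurable_fun setT
    (fun w : R => (alpha^-1)%:E * ((pos w)%:E * incgamma 0 w)).
  apply: measurable_funeM.
  by apply: emeasurable_funM; [exact: measurable_epos|exact: measurable_incgamma].
have P0 w : 0 <= (pos w)%:E * incgamma 0 w.
  by rewrite mule_ge0 ?epos_ge0 ?incgamma_ge0.
transitivity (alpha%:E * convol gpot
    (fun w => (alpha^-1)%:E * ((pos w)%:E * incgamma 0 w)) ((r - x) / alpha)).
  congr (_ * _); apply: eq_integral => y _.
  rewrite EFinM JkernelE// SpkernelE// muleC.
  have -> : ((r - (- alpha * y + r)) / alpha = y)%R.
    by field; rewrite gt_eqF.
  have -> // : ((- alpha * y + r - x) / alpha = (r - x) / alpha - y)%R.
  by field; rewrite gt_eqF.
rewrite convolZr; last 5 first.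
- exact: measurable_gpot.
- by apply: emeasurable_funM; [exact: measurable_epos|exact: measurable_incgamma].
- exact: gpot_ge0.
- exact: P0.
- by rewrite invr_ge0 ltW.
rewrite convol_gpot_incgamma0 -!EFinM mulrA divff ?gt_eqF// mul1r.
by rewrite mulrC posM// invr_gt0.
Qed.

End kernels.

(** * Inversion *)

Section ae_integral.
Context {d} {T : measurableType d} {R : realType}.
Variable mu : {measure set T -> \bar R}.
Local Open Scope ereal_scope.
Import HBNNSimple.

(** A simple function below [f], cut off on the exceptional null set, lies below [g] and keeps its
    integral; then take suprema. *)
Lemma le_ae_ge0_integralT (f g : T -> \bar R) :
  (forall x, 0 <= f x) -> (forall x, 0 <= g x) ->
  {ae mu, forall x, f x <= g x} -> \int[mu]_x f x <= \int[mu]_x g x.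
Proof.
move=> f0 g0 [N [mN N0 fgN]]; rewrite !ge0_integralTE//.
apply: ge_ereal_sup => _ [h /= hf <-].
have mNC := measurableC mN.
rewrite -integralT_nnsfun (ge0_negligible_integral mN _ _ _ N0)//; last 2 first.
- by apply/measurable_EFinP.
- by move=> x _; rewrite lee_fin.
rewrite setTD integral_nnsfun//; apply: ereal_sup_ubound.
exists (proj_nnsfun h mNC); last by rewrite -mrestrict.
move=> x.
rewrite -mrestrict patchE; case: ifPn => [|_]; last exact: g0.
rewrite inE => xN; apply: le_trans (hf x) _.
by apply: contrapT => fg; apply: xN; exact: fgN.
Qed.

(* Stated without measurability because an element of [frac_S_L1] and its
   [frac_D] are only a.e. equal to Borel functions. *)
Lemma eq_ae_integral (D : set T) (f g : T -> \bar R) :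
  {ae mu, forall x, D x -> f x = g x} ->
  \int[mu]_(x in D) f x = \int[mu]_(x in D) g x.
Proof.
move=> fg; have {}fg : {ae mu, forall x, (f \_ D) x = (g \_ D) x}.
  apply: filterS fg => x fgx; rewrite !patchE.
  by case: ifPn => //; rewrite inE.
rewrite integral_mkcond [RHS]integral_mkcond integralE [RHS]integralE.
congr (_ - _); apply/eqP; rewrite eq_le; apply/andP; split;
  apply: le_ae_ge0_integralT => //; apply: filterS fg => x;
  by rewrite ?funeposE ?funenegE => ->.
Qed.

End ae_integral.

#[export] Instance ae_lebesgue_filter (R : realType) :
  Filter (nbhs (almost_everywhere (@lebesgue_measure R))).
Proof. exact: (ae_filter_ringOfSetsType lebesgue_measure). Qed.

Section inversion.
Context {R : realType}.
Local Open Scope ereal_scope.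
Local Notation mu := (@lebesgue_measure R).
Implicit Types (a b alpha t r x : R) (phi psi f : R -> R).

Lemma ae_neq x : {ae mu, forall y : R, y <> x}.
Proof.
exists [set x]; split => //; first exact: lebesgue_measure_set1.
by move=> y /= /contrapT.
Qed.

(** The integrands can differ only at [r = t]. Since [a <= t], restricting [psi] to [[a, b]] loses
    nothing where [r > t]. *)
Lemma frac_SE alpha a b psi t : (0 < alpha)%R -> (a <= t)%R ->
  frac_S alpha b psi t =
  fine (\int[mu]_r (Spkernel alpha (r - t) * (psi \_ `[a, b]) r)%:E).
Proof.
move=> a0 at0; rewrite /frac_S /Rintegral integral_mkcond; congr fine.
apply: eq_ae_integral; apply: filterS (ae_neq t) => r /= rt _.
rewrite !patchE !mem_setE !in_itv/= /Spkernel posE subr_gt0.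
have [tr|rlt|rt'] := ltgtP t r; last by rewrite rt' in rt.
  rewrite mul1r (le_trans at0 (ltW tr)) /=.
  by case: (r <= b)%R; rewrite ?mulr0.
by rewrite mul0r mul0r.
Qed.

Section potential.
Variables (alpha a b : R) (phi : R -> R).
Hypothesis (alpha_gt0 : (0 < alpha)%R).
Hypothesis (iphi : mu.-integrable `[a, b] (EFin \o phi)).

Let phi0 : R -> R := phi \_ `[a, b].

Let iphi0 : mu.-integrable setT (EFin \o phi0).
Proof. by move: iphi; rewrite integrable_mkcond//= restrict_EFin. Qed.

Let mphi0 : measurable_fun setT phi0.
Proof. by apply/measurable_EFinP; exact: measurable_int iphi0. Qed.

Let K x t r : R := (Jkernel alpha (t - x) * Spkernel alpha (r - t))%R.

Let K_ge0 x t r : (0 <= K x t r)%R.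
Proof. by rewrite mulr_ge0// ?Jkernel_ge0 ?Spkernel_ge0. Qed.

Let mJ x : measurable_fun setT (fun t => Jkernel alpha (t - x)).
Proof.
apply: (measurableT_comp (measurable_Jkernel alpha_gt0)); exact: measurable_funB.
Qed.

Let mS : measurable_fun setT (fun z : R * R => Spkernel alpha (z.2 - z.1)).
Proof.
apply: (measurableT_comp (measurable_Spkernel alpha_gt0)).
exact: measurable_funB.
Qed.

Let mK x : measurable_fun setT (fun z : R * R => K x z.1 z.2).
Proof.
apply: measurable_funM; last exact: mS.
exact: (measurableT_comp (mJ x)).
Qed.

Let F x (z : R * R) : \bar R := (K x z.1 z.2 * phi0 z.2)%:E.

Let mF x : measurable_fun setT (F x).
Proof.
apply/measurable_EFinP; apply: measurable_funM; first exact: mK.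
exact: (measurableT_comp mphi0).
Qed.

Let integral_K x r : \int[mu]_t (K x t r)%:E = (pos (r - x))%:E.
Proof. exact: sonine. Qed.

Let mKt x r : measurable_fun setT (fun t => (K x t r)%:E).
Proof.
apply/measurable_EFinP.
exact: (measurableT_comp (mK x) (measurable_pair2 r)).
Qed.

Let integrableK x r : mu.-integrable setT (fun t => (K x t r)%:E).
Proof.
apply/integrableP; split; first exact: mKt.
under eq_integral do rewrite gee0_abs ?lee_fin ?K_ge0//.
by rewrite integral_K ltry.
Qed.

(** Integrating in [t] first, [integral_K] leaves at most [|phi0 r|]. *)
Let integrableF x : (mu \x mu).-integrable setT (F x).
Proof.
apply: (proj2 (integrable21ltyP mu mu (mF x))).
have [_ Hoo] := integrableP _ _ _ iphi0.
apply: le_lt_trans Hoo; apply: ge0_le_integral => //.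
- by move=> r _; apply: integral_ge0.
- apply: (measurable_fun_fubini_tonelli_G (m1 := mu) (abse \o F x)).
  + by apply: measurableT_comp => //; exact: mF.
  + by move=> z; exact: abse_ge0.
- by apply: measurableT_comp => //; exact: measurable_int iphi0.
- move=> r _; rewrite /F /=.
  under eq_integral do rewrite normrM ger0_norm ?K_ge0// EFinM.
  rewrite ge0_integralZr//; last 2 first.
  + exact: mKt.
  + by move=> t _; rewrite lee_fin K_ge0.
  rewrite integral_K -EFinM lee_fin ler_piMl//; exact: pos_le1.
Qed.

Let inner t : \bar R := \int[mu]_r (Spkernel alpha (r - t) * phi0 r)%:E.

(** Where the [Jkernel] factor is nonzero, [inner t] is a multiple of an integrable section, hence
    finite, and [fine] is faithful; where it vanishes, both sides are 0. *)
Let F_inner x : {ae mu, forall t, \int[mu]_r F x (t, r) =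
  (Jkernel alpha (t - x) * fine (inner t))%:E}.
Proof.
apply: filterS (ae_integrable1 (integrableF x)) => t iF.
have Ffin : \int[mu]_r F x (t, r) \is a fin_num by exact: integrable_fin_num.
have [J0|J0] := eqVneq (Jkernel alpha (t - x)) 0%R.
  rewrite J0 mul0r; apply: integral0_eq => r _.
  by rewrite /F /K /= J0 !mul0r.
rewrite -(fineK Ffin); congr EFin.
have -> : inner t = (Jkernel alpha (t - x))^-1%:E * \int[mu]_r F x (t, r).
  rewrite -integralZl//; apply: eq_integral => r _.
  by rewrite /F /K /= -EFinM; congr EFin; field.
by rewrite fineM//= mulrA divff// mul1r.
Qed.

Lemma frac_J_potential f x :
  {ae mu, forall t, t \in `[a, b] -> f t = frac_S alpha b phi t} ->
  (a <= x)%R -> (x <= b)%R ->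
  frac_J alpha b f x = (\int[mu]_(r in `]x, +oo[) (phi \_ `[a, b]) r)%R.
Proof.
move=> fS ax xb.
have an0 : (alpha != 0)%R by rewrite gt_eqF.
(* The factor [alpha] compensates the [alpha^-1] already inside [Jkernel]. *)
have -> : frac_J alpha b f x =
    (alpha^-1 * fine (\int[mu]_t (alpha%:E * \int[mu]_r F x (t, r))))%R.
  rewrite /frac_J /Rintegral integral_mkcond; congr (_ * fine _)%R.
  apply: eq_ae_integral; move: fS (ae_neq x) (F_inner x).
  apply: filterS3 => t ft tx Ft _; rewrite Ft patchE mem_setE in_itv/=.
  (* For [x < t <= b] the integrands agree by [ft]; for [t > b] the inner integral is 0, as [phi0]
     vanishes beyond [b]; for [t < x] the kernel is 0. *)
  rewrite -EFinM; have [xt|tltx|xt] := ltgtP x t; last by rewrite xt in tx.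
    case: (leP t b) => tb /=.
      have tab : t \in `[a, b] by rewrite in_itv/= tb (le_trans ax (ltW xt)).
      congr EFin; rewrite ft// (@frac_SE _ a)//; last first.
        by move: tab; rewrite in_itv/= => /andP[].
      rewrite /Jkernel posE subr_gt0 xt mul1r mulrA mulrA divff// mul1r.
      by rewrite /inner.
    rewrite (_ : inner t = 0) ?mulr0//; apply: integral0_eq => r _.
    rewrite /phi0 patchE mem_setE in_itv/=.
    case: (leP r b) => rb; last by rewrite andbF mulr0.
    rewrite /Spkernel posE subr_gt0.
    by rewrite ltNge (le_trans rb (ltW tb)) !mul0r.
  by rewrite /Jkernel posE subr_gt0 ltNge (ltW tltx) /= !mul0r mulr0.
have iF : mu.-integrable setT (fun t => \int[mu]_r F x (t, r)).
  exact: (integrable_fubini_F (integrableF x)).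
rewrite integralZl//= fineM//; last exact: integrable_fin_num.
rewrite mulrA mulVf// mul1r (Fubini (integrableF x)).
rewrite /Rintegral [in RHS]integral_mkcond; congr fine.
apply: eq_integral => r _; rewrite /F /=.
under eq_integral do rewrite EFinM.
rewrite integralZr// integral_K patchE mem_setE in_itv/= andbT.
by rewrite posE subr_gt0; case: (ltP x r) => xr /=; rewrite ?mul1e ?mul0e.
Qed.

End potential.

End inversion.

(** * Absolute continuity and derivative of the tail integral *)

Section absolute_continuity.
Context {R : realType}.
Local Notation mu := (@lebesgue_measure R).
Implicit Types (a b x y : R) (g h F G : R -> R).

Lemma tail_integralB g x y : mu.-integrable setT (EFin \o g) -> x <= y ->
  \int[mu]_(r in `]x, +oo[) g r - \int[mu]_(r in `]y, +oo[) g r =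
  \int[mu]_(r in `]x, y]) g r.
Proof.
move=> ig xy.
have E z : \int[mu]_(r in `]z, +oo[) g r =
    \int[mu]_r g r - \int[mu]_(r in `]-oo, z]) g r.
  rewrite -(@Rintegral_itvB _ g -oo%O +oo%O)// ?set_itvNyy//.
rewrite !E -(@Rintegral_itvB _ g -oo%O (BRight y))//; first by ring.
exact: integrableS ig.
Qed.

(** Absolute continuity of the integral, applied to the union of the disjoint open intervals; the
    increments live on []u k, v k]], which adds only null endpoints. *)
Lemma tail_integral_abs_continuous g a b : mu.-integrable setT (EFin \o g) ->
  abs_continuous a b (fun x => \int[mu]_(r in `]x, +oo[) g r).
Proof.
move=> ig e e0; have [d [d0 Hd]] := integral_normr_continuous ig e0.
exists d => // n u v uv tuv suv.
pose D := \big[setU/set0]_(k <- index_enum 'I_n) `]u k, v k[%classic.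
have mg : measurable_fun setT g by apply/measurable_EFinP; exact: measurable_int ig.
have mng : measurable_fun setT (fun x => (`|g x|)%:E).
  by apply/measurable_EFinP; exact: measurableT_comp.
have mI k : measurable (`]u k, v k[%classic : set R) by [].
have mD : measurable D by apply: bigsetU_measurable.
have tI : trivIset [set` index_enum 'I_n] (fun k => `]u k, v k[%classic).
  by apply: sub_trivIset tuv.
have muD : (mu D < d%:E)%E.
  rewrite -(mul1e (mu D)) -integral_cst// /D ge0_integral_bigsetU//; last first.
    exact: index_enum_uniq.
  apply: (@le_lt_trans _ _ (\sum_(k < n) (v k - u k))%:E); last by rewrite lte_fin.
  rewrite -sumEFin; apply: lee_sum => k _.
  rewrite integral_cst//= mul1e lebesgue_measure_itv/= lte_fin.
  have [_ [uvk _]] := uv k.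
  by case: ifPn => // _; rewrite lee_fin subr_ge0.
apply: le_lt_trans (Hd D mD muD).
have itg k : mu.-integrable `]u k, v k] (EFin \o g) by exact: integrableS ig.
rewrite -lee_fin /Rintegral fineK; last first.
  rewrite ge0_fin_numE; last by apply: integral_ge0.
  have : mu.-integrable D (EFin \o g) by exact: integrableS ig.
  by case/integrableP.
rewrite /D ge0_integral_bigsetU//; last 2 first.
  exact: index_enum_uniq.
  exact: measurable_funTS.
rewrite -sumEFin; apply: lee_sum => k _; have [_ [uvk _]] := uv k.
rewrite distrC tail_integralB//.
rewrite EFin_normr_Rintegral//.
apply: (le_trans (le_abse_integral _ _ _)) => //; first exact: measurable_int (itg k).
rewrite integral_itv_bndoo//; exact: measurable_funTS.
Qed.

Lemma tail_integral_derive g : mu.-integrable setT (EFin \o g) ->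
  {ae mu, forall x,
    derive1 (fun x => \int[mu]_(r in `]x, +oo[) g r) x = - g x}.
Proof.
move=> ig.
have ig' y : mu.-integrable [set` Interval -oo%O (BRight y)] (EFin \o g).
  exact: integrableS ig.
have loc : locally_integrable [set: R] g.
  by apply: open_integrable_locally => //; exact: openT.
apply: filterS (FTC1Ny ig' loc) => x [dF F'x].
rewrite (_ : (fun x => _) =
  (fun x => \int[mu]_r g r - \int[mu]_(r in `]-oo, x]) g r)); last first.
  apply/funext => z; rewrite -(@Rintegral_itvB _ g -oo%O +oo%O)// ?set_itvNyy//.
rewrite derive1E deriveB; [|exact: derivable_cst|exact: dF].
by rewrite derive_cst -derive1E F'x sub0r.
Qed.

(** Valid for every [g]: [fine] sends all infinite outcomes to 0. This matters because [frac_S] may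
    be evaluated where its integrand is not integrable. *)
Lemma RintegralN (D : set R) g :
  \int[mu]_(t in D) (- g t) = - \int[mu]_(t in D) g t.
Proof.
pose h : R -> \bar R := EFin \o g.
rewrite /Rintegral -[X in fine X]/(\int[mu]_(t in D) (\- h)%E t)%E.
rewrite -[X in - fine X]/(\int[mu]_(t in D) h t)%E.
rewrite (integralE mu D (\- h)%E) (integralE mu D h) funeposN funenegN.
have : (0 <= \int[mu]_(x in D) h^\+ x)%E by exact: integral_ge0.
have : (0 <= \int[mu]_(x in D) h^\- x)%E by exact: integral_ge0.
case: (integral mu D h^\-)%E => [p||//] _;
  by case: (integral mu D h^\+)%E => [q||//] _ /=; rewrite ?oppr0// opprB.
Qed.

Lemma frac_SN alpha b g x :
  frac_S alpha b (\- g) x = - frac_S alpha b g x.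
Proof.
by rewrite /frac_S -RintegralN; apply: eq_Rintegral => t _; rewrite mulrN.
Qed.

Lemma abs_continuous_uniform a b F e : abs_continuous a b F -> 0 < e ->
  exists2 d, 0 < d & forall x y, a <= x -> x <= y -> y <= b -> y - x < d ->
    `|F y - F x| < e.
Proof.
move=> acF e0; have [d d0 Hd] := acF e e0; exists d => // x y ax xy yb yxd.
have := Hd 1 (fun=> x) (fun=> y); rewrite !big_ord1; apply => //.
by apply/trivIsetP => i j _ _; rewrite !ord1 eqxx.
Qed.

(** The exceptional null set cannot contain an interval to the right of [x], so [F] and [G] agree at
    points arbitrarily close to [x], and continuity concludes. This neutralizes the choice made in
    [ac_rep]. *)
Lemma ac_rep_unique a b h F G x : ac_rep_of a b h F -> ac_rep_of a b h G ->
  a < x -> x < b -> F x = G x.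
Proof.
move=> [acF hF] [acG hG] ax xb.
have [N [mN N0 FGN]] : {ae mu, forall y, y \in `[a, b] -> F y = G y}.
  by apply: filterS2 hF hG => y hFy hGy yab; rewrite -hFy// hGy.
apply/eqP; rewrite -subr_eq0 -normr_le0; apply/ler_addgt0Pr => e e0.
have e20 : 0 < e / 2 by rewrite divr_gt0.
have [d1 d10 Hd1] := abs_continuous_uniform acF e20.
have [d2 d20 Hd2] := abs_continuous_uniform acG e20.
pose z := Num.min b (x + Num.min d1 d2).
have xz : x < z by rewrite lt_min xb ltrDl lt_min d10 d20.
have [y [xy yz Fy]] : exists y, [/\ x < y, y < z & F y = G y].
  apply: contrapT => nex.
  have : (mu `]x, z[%classic <= mu N)%E.
    apply: le_measure; rewrite ?inE//; apply: subset_trans FGN => y /=.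
    rewrite in_itv/= => /andP[xy yz] H; apply: nex; exists y; split=> //.
    apply: H; rewrite in_itv/= (le_trans (ltW ax) (ltW xy)) /=.
    by move: yz; rewrite lt_min => /andP[/ltW].
  by rewrite N0 lebesgue_measure_itv/= lte_fin xz -EFinB lee_fin leNgt subr_gt0 xz.
move: yz; rewrite !lt_min => /andP[yb]; rewrite -ltrBlDl lt_min => /andP[yd1 yd2].
have := Hd1 x y (ltW ax) (ltW xy) (ltW yb) yd1.
have := Hd2 x y (ltW ax) (ltW xy) (ltW yb) yd2.
rewrite Fy add0r => G1 F1.
have -> : F x - G x = (G y - G x) - (G y - F x) by ring.
by rewrite (le_trans (ler_normB _ _))//; lra.
Qed.

End absolute_continuity.

Unset Implicit Arguments.

Theorem theorem4p6 (R : realType) (alpha a b : R) (f : R -> R)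
  (halpha : 0 < alpha) (hab : a < b) (hf : frac_S_L1 alpha a b f) :
  has_ac_rep a b (frac_J alpha b f) /\
  {ae lebesgue_measure, forall x, x \in `[a, b] ->
    frac_S alpha b (frac_D alpha a b f) x = - f x}.
Proof.
case: hf => phi iphi fS.
pose g := phi \_ `[a, b].
pose G x := \int[lebesgue_measure]_(r in `]x, +oo[) g r.
have ig : lebesgue_measure.-integrable setT (EFin \o g).
  by move: iphi; rewrite integrable_mkcond//= restrict_EFin.
have acG : ac_rep_of a b (frac_J alpha b f) G.
  split; first exact: tail_integral_abs_continuous.
  apply: nearW => x; rewrite in_itv/= => /andP[ax xb].
  exact: (frac_J_potential halpha iphi fS).
split; first by exists G.
have acF : ac_rep_of a b (frac_J alpha b f) (ac_rep a b (frac_J alpha b f)).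
  exact: (xgetPex _ (ex_intro _ G acG)).
have DE : {ae lebesgue_measure, forall x, a < x -> x < b ->
    frac_D alpha a b f x = - phi x}.
  apply: filterS (tail_integral_derive ig) => x G'x ax xb.
  have -> : frac_D alpha a b f x = derive1 G x.
    (* The chosen representative agrees with [G] only inside []a, b[], but this is a neighbourhood
       of [x], so the derivatives coincide. *)
    rewrite /frac_D !derive1E; apply: near_eq_derive.
    near=> y; apply: (ac_rep_unique acF acG).
      by near: y; exact: lt_nbhsr.
    by near: y; exact: lt_nbhsl.
  by rewrite G'x /g patchE mem_setE in_itv/= (ltW ax) (ltW xb).
apply: filterS fS => x fx xab; rewrite fx//.
move: xab; rewrite in_itv/= => /andP[ax xb].
(* [x] is fixed and the integrands are compared for almost every [t]; [t = x] and [t = b] are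
   discarded because [DE] covers only the open interval. *)
have -> : frac_S alpha b (frac_D alpha a b f) x = frac_S alpha b (\- phi) x.
  rewrite /frac_S /Rintegral; congr fine.
  apply: eq_ae_integral; move: DE (ae_neq x) (ae_neq b).
  apply: filterS3 => t Dt tx tb; rewrite /= in_itv/= => /andP[xt tb'].
  rewrite Dt//.
    by rewrite (le_lt_trans ax)// lt_neqAle xt andbT; apply/eqP => /esym.
  by rewrite lt_neqAle tb' andbT; apply/eqP.
exact: frac_SN.
Unshelve. all: by end_near. Qed.
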